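(* Let $n\ge 1$, let $A=\{1,\dots,p\}$ and $A'=\{1',\dots,s'\}$ be alphabets with a total order $\prec$ on $A\sqcup A'$ that respects the orders on $A$ and on $A'$, and let $\lambda/\mu$ be a skew partition tileable by $n$-ribbons. Then the partition function of the $n$-ribbon lattice model with boundary conditions and spectral parameters $\mathcal B_{\lambda/\mu}(X/Y)$ equals the super LLT polynomial of shape $\lambda/\mu$: $$Z\left(\mathcal B_{\lambda/\mu}(X/Y)\right)=\mathcal G^{(n)}_{\lambda/\mu}(X/Y;q).$$
   Context: **Ribbons and super LLT polynomials.** Partitions are identified with Young diagrams (left-justified rows, the $i$-th row from the top having $\lambda_i$ boxes), up to trailing zeros; $\ell(\lambda)$ is the number of parts; $\lambda/\mu$ is defined when $\mu\subset\lambda$. An $n$-ribbon is a connected skew shape with $n$ boxes containing no $2\times2$ square; its spin is its number of rows minus one. A tiling of a skew shape by $n$-ribbons is a horizontal $n$-ribbon strip if the top-right-most square of each ribbon touches the northern boundary of the shape (the square directly above it is not in the shape). It is a vertical $n$-ribbon strip if its reflection in the main diagonal is a horizontal $n$-ribbon strip of the conjugate shape. A super $n$-ribbon tableau $T$ of shape $\lambda/\mu$ is a tiling of $\lambda/\mu$ by $n$-ribbons labelled by elements of $A\sqcup A'$ such that, for each label $i$, $\mu$ together with the ribbons with labels $\preceq i$ is a Young diagram, the ribbons labelled by any $a\in A$ form a horizontal $n$-ribbon strip and the ribbons labelled by any $b\in A'$ form a vertical $n$-ribbon strip. $\operatorname{spin}(T)$ is the sum of the spins of its ribbons; $\operatorname{wt}(T)$,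 $\operatorname{wt}'(T)$ record the number of ribbons with each label in $A$, $A'$ respectively. With variables $X=(x_i)_{i\in A}$, $Y=(y_{i'})_{i'\in A'}$, the super LLT polynomial is $$\mathcal G^{(n)}_{\lambda/\mu}(X/Y;q)=\sum_T q^{\operatorname{spin}(T)}x^{\operatorname{wt}(T)}(-y)^{\operatorname{wt}'(T)},$$ the sum being over all super $n$-ribbon tableaux of shape $\lambda/\mu$. **$n$-ribbon lattice model.** On a finite rectangular grid of vertices, each vertical edge carries a label in $\{\wedge,\vee\}$ (arrow up/down) and each horizontal edge carries an $n$-tuple of labels in $\{<,>\}$ (arrows left/right). For a vertex $v$ write $v_N,v_S$ for the labels of the vertical edges above and below it, and $v_W=(v_W(1),\dots,v_W(n))$, $v_E=(v_E(1),\dots,v_E(n))$ for the tuples on the horizontal edges to its left and right. (The edge between horizontally adjacent vertices $u$, left, and $v$, right, is shared: $u_E(i)=v_W(i)$ for all $i$.) A vertex is admissible if the number of arrows pointing in equals the number pointing out and $v_E(i)=v_W(i+1)$ for $1\le i\le n-1$. An admissible vertex has one of six types, given by $(v_N,v_S,v_W(1),v_E(n))$: SW: $(\wedge,\wedge,>,>)$; NS: $(\vee,\wedge,<,>)$; SE: $(\wedge,\wedge,<,<)$; NW: $(\vee,\vee,>,>)$; EW: $(\wedge,\vee,>,<)$; NE: $(\vee,\vee,<,<)$. Let $s$ be the number of left arrows $<$ among $v_E(1),\dots,v_E(n-1)$. Weights in a horizontal strip row with spectral parameter $x_i$: SW: $q^s$; NS: $q^s$; SE: $0$; NW: $1$;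 EW: $q^sx_i$; NE: $q^sx_i$. Weights in a vertical strip row with spectral parameter $y_{i'}$: SW: $q^s$; NS: $1$; SE: $-y_{i'}$; NW: $1$; EW: $-y_{i'}$; NE: $0$. Non-admissible vertices have weight $0$. The weight of a state (an assignment of labels to all edges compatible with the boundary conditions) is the product of its vertex weights, and the partition function $Z$ is the sum of the weights of all states. **Boundary conditions.** Fix $r\ge\ell(\lambda)$ and let $\rho=(r,r-1,\dots,1)$. $\mathcal B_{\lambda/\mu}(X/Y)$ is the system with $|A|+|A'|$ rows, labelled from top to bottom by the elements of $A\sqcup A'$ in increasing order for $\prec$, and $\lambda_1+r$ columns, numbered $1,2,\dots$ from left to right. A row labelled $i\in A$ is a horizontal strip row with spectral parameter $x_i$; a row labelled $i'\in A'$ is a vertical strip row with spectral parameter $y_{i'}$. All labels on the left and right boundary edges are $>$. The bottom boundary edge in column $c$ is $\wedge$ if $c$ is a part of $\lambda+\rho$ and $\vee$ otherwise; the top boundary edge in column $c$ is $\wedge$ if $c$ is a part of $\mu+\rho$ and $\vee$ otherwise. *)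

(* Defs.v *)
From HB Require Import structures.
From mathcomp Require Import all_boot all_order all_algebra.

Set Implicit Arguments.
Unset Strict Implicit.
Unset Printing Implicit Defensive.

Import GRing.Theory.
Local Open Scope nat_scope.

(* Partitions are taken up to trailing zeros: zero parts are allowed in the
   sequence, and [nparts] counts the nonzero ones only. *)
Definition is_partition (la : seq nat) : bool := sorted geq la.
Definition nparts (la : seq nat) : nat := count (leq 1) la.
Definition subpartition (mu la : seq nat) : Prop :=
  forall i, nth 0 mu i <= nth 0 la i.

(* Boxes are pairs (row, column), counted from 0 at the top left, inside an
   ambient m x k rectangle. *)
Notation box m k := ('I_m * 'I_k)%type.

Section Shapes.
Variables m k : nat.
Implicit Types (b c : box m k) (D S : {set box m k}) (P : {set {set box m k}}).

Definition diagram (la : seq nat) : {set box m k} :=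
  [set b : box m k | b.2 < nth 0 la b.1].

(* In the m x k rectangle every Young diagram has at most m parts, each <= k. *)
Definition is_young D : bool :=
  [exists la : m.-tuple 'I_k.+1,
    is_partition (map val la) && (D == diagram (map val la))].

Definition is_skew S : bool :=
  [exists D : {set box m k}, exists E : {set box m k},
    [&& is_young D, is_young E, E \subset D & S == D :\: E]].

Definition adjacent b c : bool :=
  ((b.1 == c.1) && ((b.2.+1 == c.2 :> nat) || (c.2.+1 == b.2 :> nat)))
  || ((b.2 == c.2) && ((b.1.+1 == c.1 :> nat) || (c.1.+1 == b.1 :> nat))).

Definition connected S : bool :=
  [forall b in S, forall c in S,
    connect (fun u v => [&& u \in S, v \in S & adjacent u v]) b c].

Definition has_square S : bool :=
  [exists b in S, exists c in S,
    [&& c.1 == b.1.+1 :> nat, c.2 == b.2.+1 :> nat,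
        (b.1, c.2) \in S & (c.1, b.2) \in S]].

Definition is_ribbon (n : nat) S : bool :=
  [&& is_skew S, connected S, #|S| == n & ~~ has_square S].

Definition ribbon_spin S : nat := #|[set b.1 | b in S]|.-1.

Definition ribbon_tiling (n : nat) D P : bool :=
  [&& is_skew D, partition P D & [forall S in P, is_ribbon n S]].

Definition top_right_most S b : bool :=
  (b \in S) && [forall c in S, (b.1 <= c.1) && (c.2 <= b.2)].

Definition touches_north D b : bool :=
  ~~ [exists c in D, (c.1.+1 == b.1 :> nat) && (c.2 == b.2)].

Definition horizontal_strip (n : nat) D P : bool :=
  ribbon_tiling n D P &&
  [forall S in P, forall b, top_right_most S b ==> touches_north D b].

End Shapes.

Definition reflect_box m k (b : box m k) : box k m := (b.2, b.1).
Definition reflect_shape m k (S : {set box m k}) : {set box k m} :=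
  [set reflect_box b | b in S].
Definition reflect_tiling m k (P : {set {set box m k}}) : {set {set box k m}} :=
  [set reflect_shape S | S in P].

Definition vertical_strip m k (n : nat)
    (D : {set box m k}) (P : {set {set box m k}}) : bool :=
  horizontal_strip n (reflect_shape D) (reflect_tiling P).

(* The bounding rectangle of la. *)
Notation boxes la := (box (nparts la) (head 0 la)).

Definition skew (la mu : seq nat) : {set boxes la} :=
  diagram _ _ la :\: diagram _ _ mu.

Definition tileable (n : nat) (la mu : seq nat) : bool :=
  [exists P : {set {set boxes la}}, ribbon_tiling n (skew la mu) P].

(* [inl a] is the letter a of A = {1, ..., p}, [inr b] the letter b of
   A' = {1', ..., s'}, both counted from 0. *)
Notation letter p s := ('I_p + 'I_s)%type.

Section SuperTableaux.
Variables (n p s : nat) (prec : rel (letter p s)) (la mu : seq nat).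

(* A labelled tiling is the set of its ribbons, each paired with its label. *)
Notation labelled := {set {set boxes la} * letter p s}.
Implicit Type T : labelled.

Definition ribbons T : {set {set boxes la}} := [set t.1 | t in T].
Definition ribbons_with T (l : letter p s) : {set {set boxes la}} :=
  [set t.1 | t in T & t.2 == l].

Definition super_tableau T : bool :=
  [&& ribbon_tiling n (skew la mu) (ribbons T),
      [forall t in T, forall u in T, (t.1 == u.1) ==> (t.2 == u.2)],
      [forall l : letter p s,
        is_young (diagram _ _ mu :|: \bigcup_(t in T | prec t.2 l) t.1)],
      [forall a : 'I_p,
        horizontal_strip n (cover (ribbons_with T (inl a)))
                           (ribbons_with T (inl a))] &
      [forall b : 'I_s,
        vertical_strip n (cover (ribbons_with T (inr b)))
                         (ribbons_with T (inr b))]].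

Definition spin T : nat := \sum_(S in ribbons T) ribbon_spin S.
Definition wt T (a : 'I_p) : nat := #|ribbons_with T (inl a)|.
Definition wt' T (b : 'I_s) : nat := #|ribbons_with T (inr b)|.

Local Open Scope ring_scope.

Definition super_LLT (R : comNzRingType)
    (q : R) (x : 'I_p -> R) (y : 'I_s -> R) : R :=
  \sum_(T : labelled | super_tableau T)
    q ^+ spin T * \prod_(a < p) x a ^+ wt T a * \prod_(b < s) (- y b) ^+ wt' T b.

End SuperTableaux.

Variant varrow := Up | Down.
Variant harrow := Left | Right.

Definition bool_of_varrow (a : varrow) : bool := if a is Up then true else false.
Definition varrow_of_bool (b : bool) : varrow := if b then Up else Down.
Lemma bool_of_varrowK : cancel bool_of_varrow varrow_of_bool.
Proof. by case. Qed.
HB.instance Definition _ := Finite.copy varrow (can_type bool_of_varrowK).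

Definition bool_of_harrow (a : harrow) : bool := if a is Left then true else false.
Definition harrow_of_bool (b : bool) : harrow := if b then Left else Right.
Lemma bool_of_harrowK : cancel bool_of_harrow harrow_of_bool.
Proof. by case. Qed.
HB.instance Definition _ := Finite.copy harrow (can_type bool_of_harrowK).

Section Vertices.
Variable n : nat.
Implicit Types (N S : varrow) (W E : n.-tuple harrow).

Definition arrows_in N S W E : nat :=
  (N == Down) + (S == Up) + count_mem Right W + count_mem Left E.
Definition arrows_out N S W E : nat :=
  (N == Up) + (S == Down) + count_mem Left W + count_mem Right E.

(* Tuple entries are counted from 0: v_E(i) is [nth Right E i.-1].  The default
   [Right] of [nth] is never reached when n >= 1. *)
Definition admissible N S W E : bool :=
  (arrows_in N S W E == arrows_out N S W E) &&
  [forall i : 'I_n.-1, nth Right E i == nth Right W i.+1].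

Variant vertex_type := SW | NS | SE | NW | EW | NE.

Definition type_of N S W E : option vertex_type :=
  match N, S, nth Right W 0, nth Right E n.-1 with
  | Up, Up, Right, Right => Some SW
  | Down, Up, Left, Right => Some NS
  | Up, Up, Left, Left => Some SE
  | Down, Down, Right, Right => Some NW
  | Up, Down, Right, Left => Some EW
  | Down, Down, Left, Left => Some NE
  | _, _, _, _ => None
  end.

Definition left_arrows E : nat := count_mem Left (take n.-1 E).

Variable R : comNzRingType.
Implicit Types q x y : R.
Local Open Scope ring_scope.

Definition horizontal_weight q x (s : nat) (t : vertex_type) : R :=
  match t with
  | SW => q ^+ s
  | NS => q ^+ s
  | SE => 0
  | NW => 1
  | EW => q ^+ s * x
  | NE => q ^+ s * x
  end.

Definition vertical_weight q y (s : nat) (t : vertex_type) : R :=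
  match t with
  | SW => q ^+ s
  | NS => 1
  | SE => - y
  | NW => 1
  | EW => - y
  | NE => 0
  end.

Definition vertex_weight (p s : nat) q (x : 'I_p -> R) (y : 'I_s -> R)
    (l : letter p s) N S W E : R :=
  if admissible N S W E then
    if type_of N S W E is Some t then
      match l with
      | inl a => horizontal_weight q (x a) (left_arrows E) t
      | inr b => vertical_weight q (y b) (left_arrows E) t
      end
    else 0
  else 0.

End Vertices.

Section Model.
Variables (n p s : nat) (prec : rel (letter p s)) (la mu : seq nat) (r : nat).

Notation nrows := #|{: letter p s}|.
Notation ncols := (head 0 la + r).

Definition row_letter (i : 'I_nrows) : letter p s :=
  tnth (sort_tuple prec (enum_tuple {: letter p s})) i.

(* The parts of la + rho, where rho = (r, r - 1, ..., 1). *)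
Definition shifted_parts (nu : seq nat) : seq nat :=
  [seq nth 0 nu i + (r - i) | i <- iota 0 r].

(* Vertical edges: [st.1 (i, c)] is the edge of column c above row i, or below
   row i - 1; so i = 0 is the top boundary and i = nrows the bottom one.
   Horizontal edges: [st.2 (i, c)] is the edge of row i to the left of column c,
   or to the right of column c - 1. *)
Notation state :=
  ({ffun 'I_nrows.+1 * 'I_ncols -> varrow} *
   {ffun 'I_nrows * 'I_ncols.+1 -> n.-tuple harrow})%type.
Implicit Type st : state.

Definition edge_N st (i : 'I_nrows) (c : 'I_ncols) : varrow :=
  st.1 (widen_ord (leqnSn _) i, c).
Definition edge_S st (i : 'I_nrows) (c : 'I_ncols) : varrow :=
  st.1 (lift ord0 i, c).
Definition edge_W st (i : 'I_nrows) (c : 'I_ncols) : n.-tuple harrow :=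
  st.2 (i, widen_ord (leqnSn _) c).
Definition edge_E st (i : 'I_nrows) (c : 'I_ncols) : n.-tuple harrow :=
  st.2 (i, lift ord0 c).

(* Columns are numbered from 1, so the ordinal c stands for column c.+1. *)
Definition boundary_arrow (nu : seq nat) (c : 'I_ncols) : varrow :=
  if c.+1 \in shifted_parts nu then Up else Down.

Definition boundary st : bool :=
  [&& [forall c, st.1 (ord0, c) == boundary_arrow mu c],
      [forall c, st.1 (ord_max, c) == boundary_arrow la c],
      [forall i, st.2 (i, ord0) == nseq_tuple n Right] &
      [forall i, st.2 (i, ord_max) == nseq_tuple n Right]].

Local Open Scope ring_scope.

Definition state_weight (R : comNzRingType)
    (q : R) (x : 'I_p -> R) (y : 'I_s -> R) st : R :=
  \prod_(i < nrows) \prod_(c < ncols)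
    vertex_weight q x y (row_letter i)
      (edge_N st i c) (edge_S st i c) (edge_W st i c) (edge_E st i c).

Definition partition_function (R : comNzRingType)
    (q : R) (x : 'I_p -> R) (y : 'I_s -> R) : R :=
  \sum_(st : state | boundary st) state_weight q x y st.

End Model.

(* Main.v *)
From mathcomp Require Import all_boot all_order all_algebra zify.
Require Import Defs.

(** A Young diagram is read off its boundary: going from the south-west to the
north-east, a vertical step is a bead and a horizontal step is a gap. This bead
sequence is the sequence of vertical arrows (bead = up arrow) that a partition
puts on a boundary of the lattice. Removing an [n]-ribbon moves one bead [n]
places to the left onto a gap ([bead_move], [rim_removable]), and the ribbon has
one row more than there are beads strictly between the two places
([ribbon_spin_beads]).

In a horizontal strip, two ribbons never cross: the one that lies further to the
south-east on a common diagonal has the larger head content, since otherwise the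
box above its head would belong to the strip ([strip_noncrossing]). So the ribbon
with the rightmost head can be peeled off, and by induction the strip amounts to
a set [L] of places from which beads are launched one after the other, from left
to right, each flying [n] places ([strip_launches], [launches_strip]). The set
[L] is determined by the two diagrams, hence so is the tiling ([strip_uniq]).

In a row of the lattice, horizontal arrows are transported without change over
[n] columns. Therefore an admissible row is also a set of launches
([row_admissible_launches]), subject to the same conservation law. The weight of
a horizontal row vanishes when a particle lands on an occupied place, and
otherwise it pays one factor [q] for every launch and every particle present at a
place under its flight. These are exactly the beads jumped over by the ribbon, so
that a row sums up to the strips between the two diagrams ([row_sum_strips]).
Vertical rows and vertical strips reduce to horizontal ones: reflection in the
main diagonal reverses the bead sequence and exchanges beads and gaps
([bead_reflect]), and the same operation on a row of the lattice exchanges the two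
exclusion rules. In order to treat both at once, the weights in [strip_launches]
use two parameters, [q] for the rows and [t] for the columns of a ribbon.

It remains to assemble rows. A super tableau is a chain of Young diagrams
together with a strip between consecutive ones ([super_LLT_chains]); the
partition function is a sum over sequences of rows of vertical arrows
([partition_function_rows]). A sequence which does not come from a chain
contributes zero, as one sees from the bottom row upwards
([row_sum_strip_cases]). *)

Set Implicit Arguments.
Unset Strict Implicit.
Unset Printing Implicit Defensive.

Import GRing.Theory.

(** * Young diagrams and their diagonals *)

Section Boxes.
Variables m k : nat.
Implicit Types (b c d : box m k) (D E S : {set box m k}).

Lemma box_eq b c : b.1 = c.1 :> nat -> b.2 = c.2 :> nat -> b = c.
Proof. by case: b c => [b1 b2] [c1 c2] /= /ord_inj-> /ord_inj->. Qed.

Lemma box_ex i j : i < m -> j < k -> exists2 b : box m k, b.1 = i :> nat & b.2 = j :> nat.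
Proof. by move=> him hjk; exists (Ordinal him, Ordinal hjk). Qed.

Definition down_closed D := forall b c,
  b \in D -> c.1 <= b.1 -> c.2 <= b.2 -> c \in D.

Lemma nth_partition la i j :
  is_partition la -> i <= j -> nth 0 la j <= nth 0 la i.
Proof.
move=> sla ij; case: (ltnP j (size la)) => hj; last by rewrite nth_default.
have tr : transitive geq by move=> y x z /= xy yz; exact: leq_trans yz xy.
by apply: (sorted_leq_nth tr leqnn 0 sla) => //; rewrite inE //; lia.
Qed.

Lemma down_closed_diagram la : is_partition la -> down_closed (diagram m k la).
Proof.
move=> hla b c; rewrite !inE => hb h1 h2.
by have := nth_partition hla h1; lia.
Qed.

Lemma card_ord_lt n j : #|[set i : 'I_n | i < j]| = minn j n.
Proof.
have hle: minn j n <= n by lia.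
rewrite -[RHS]card_ord -(@card_imset _ _ (widen_ord hle));
  last by move=> i1 i2 /(congr1 val) e; exact: ord_inj.
apply: eq_card => i.
rewrite !inE; apply/idP/imsetP => [ij|[i0 _ ->]] /=; last by have := ltn_ord i0; lia.
have ij' : i < minn j n by have := ltn_ord i; lia.
by exists (Ordinal ij') => //; apply: ord_inj.
Qed.

Lemma down_set_card n (A : {set 'I_n}) :
  (forall i j : 'I_n, i \in A -> j <= i -> j \in A) ->
  forall j, (j \in A) = (j < #|A|).
Proof.
move=> clA j; apply/idP/idP => [jA|].
  have : [set i : 'I_n | i < j.+1] \subset A.
    by apply/subsetP => i; rewrite inE ltnS => /(clA _ _ jA).
  move/subset_leq_card; rewrite card_ord_lt; apply: leq_trans.
  by have := ltn_ord j; lia.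
apply: contraLR => jA; rewrite -leqNgt.
have : A \subset [set i : 'I_n | i < j].
  apply/subsetP => i iA; rewrite inE ltnNge; apply: contra jA; exact: clA.
move/subset_leq_card; rewrite card_ord_lt => h; apply: leq_trans h _; lia.
Qed.

Lemma young_diagramP D : reflect
  (exists la, [/\ is_partition la, forall i, nth 0 la i <= k, size la = m
                & D = diagram m k la]) (is_young D).
Proof.
apply: (iffP existsP) => [[la /andP[sla /eqP->]]|[la [sla hk hm ->]]].
  exists (map val la); split => //; last by rewrite size_map size_tuple.
  move=> i; case: (ltnP i (size la)) => hi; last by rewrite nth_default // size_map.
  by rewrite (nth_map ord0) // -ltnS ltn_ord.
exists [tuple inord (nth 0 la i) | i < m].
suff -> : map val [tuple (inord (nth 0 la i) : 'I_k.+1) | i < m] = la by rewrite sla /=.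
apply: (@eq_from_nth _ 0); first by rewrite size_map size_tuple.
move=> i; rewrite size_map size_tuple => hi.
rewrite (nth_map ord0) ?size_tuple // -[i]/(val (Ordinal hi)) -tnth_nth tnth_mktuple.
by have /= := inordK (_ : nth 0 la i < k.+1); apply; rewrite ltnS.
Qed.

(** Allows Young diagrams to be handled without reference to row lengths. *)
Lemma youngP D : reflect (down_closed D) (is_young D).
Proof.
apply: (iffP (young_diagramP D)) => [[la [sla _ _ ->]]|clD].
  exact: down_closed_diagram.
pose f (i : 'I_m) := #|[set j : 'I_k | (i, j) \in D]|.
have fP (i : 'I_m) (j : 'I_k) : ((i, j) \in D) = (j < f i).
  rewrite -down_set_card ?inE // => j1 j2; rewrite !inE => hj1 hj;
    exact: (clD _ (i, j2) hj1 (leqnn _) hj).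
exists [tuple f i | i < m]; split; last first.
- apply/setP => -[i j]; rewrite inE fP.
  have -> : nth 0 [tuple f i | i < m] (i, j).1 = f i by rewrite -tnth_nth tnth_mktuple.
  by [].
- by rewrite size_tuple.
- move=> i; case: (ltnP i m) => hi; last by rewrite nth_default ?size_tuple.
  rewrite -[i]/(val (Ordinal hi)) -tnth_nth tnth_mktuple.
  by rewrite -[X in _ <= X]card_ord max_card.
apply/(sortedP 0) => i; rewrite size_tuple => hi.
have hi' := ltnW hi.
have nthf (i0 : 'I_m) : nth 0 [tuple f i | i < m] i0 = f i0 by rewrite -tnth_nth tnth_mktuple.
rewrite (nthf (Ordinal hi')) (nthf (Ordinal hi)) /f.
apply: subset_leq_card; apply/subsetP => j; rewrite !inE => h.
by apply: (clD _ _ h) => //=.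
Qed.

Lemma skew_convex S b c d : is_skew S -> b \in S -> d \in S ->
  b.1 <= c.1 -> b.2 <= c.2 -> c.1 <= d.1 -> c.2 <= d.2 -> c \in S.
Proof.
move=> /existsP[D /existsP[E /and4P[/youngP yD /youngP yE _ /eqP->]]].
rewrite !inE => /andP[bE _] /andP[_ dD] h1 h2 h3 h4.
rewrite (yD _ _ dD) // andbT; apply: contra bE => cE; exact: yE cE _ _.
Qed.

Lemma skewD D E : is_young D -> is_young E -> E \subset D -> is_skew (D :\: E).
Proof.
by move=> yD yE sub; apply/existsP; exists D; apply/existsP; exists E; rewrite yD yE sub /=.
Qed.

Variable r : nat.

(** The content of a box, shifted by [r]: as soon as [r] bounds the number of
rows, this truncated difference is an honest positive number. *)
Definition cont b := b.2 + r - b.1.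

Definition diag D (e : nat) := #|[set b in D | cont b == e]|.

Lemma diagD D S e : S \subset D -> diag D e = diag (D :\: S) e + diag S e.
Proof.
move=> sub; rewrite /diag addnC -(cardsID S); congr (_ + _); apply: eq_card => b.
  by rewrite !inE; case bS: (b \in S); rewrite ?andbT ?andbF //= (subsetP sub _ bS).
by rewrite !inE; case: (b \in S); rewrite ?andbT ?andbF.
Qed.

Lemma diag_gt0 D b : b \in D -> 0 < diag D (cont b).
Proof. by move=> bD; apply/card_gt0P; exists b; rewrite inE bD eqxx. Qed.

Hypothesis hr : m <= r.

Lemma contE b : cont b + b.1 = b.2 + r.
Proof. by rewrite /cont subnK //; have := ltn_ord b.1; lia. Qed.

Lemma cont_above b c : c.1.+1 = b.1 :> nat -> c.2 = b.2 -> cont c = (cont b).+1.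
Proof. by move=> c1 c2; have := contE b; have := contE c; rewrite c2 -c1; lia. Qed.

Lemma cont_inj b c : cont b = cont c -> minn b.1 b.2 = minn c.1 c.2 -> b = c.
Proof.
move=> h1 h2; have := ltn_ord b.1; have := ltn_ord c.1; rewrite /cont in h1.
by move=> hb hc; apply: box_eq; lia.
Qed.

Lemma cont_le b c : cont b = cont c ->
  minn b.1 b.2 <= minn c.1 c.2 -> (b.1 <= c.1) && (b.2 <= c.2).
Proof.
rewrite /cont => h1 h2; have := ltn_ord b.1; have := ltn_ord c.1; lia.
Qed.

Lemma diag_exgt D e t : t < diag D e ->
  exists b, [/\ b \in D, cont b = e & t <= minn b.1 b.2].
Proof.
move=> ht; case: (boolP [exists b in D, (cont b == e) && (t <= minn b.1 b.2)]).
  by case/exists_inP => b bD /andP[/eqP be tb]; exists b.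
rewrite negb_exists => /forallP hb; exfalso.
case: t ht hb => [|t] ht hb.
  have /card_gt0P[b] := ht; rewrite inE => /andP[bD be].
  by have := hb b; rewrite bD be.
suff : diag D e <= t.+1 by lia.
rewrite -[t.+1]card_ord /diag.
apply: (@leq_card_in _ _ (fun b => inord (minn b.1 b.2) : 'I_t.+1)) => b c.
rewrite !inE => /andP[bD /eqP be] /andP[cD /eqP ce] /(congr1 val) /=.
have := hb b; have := hb c; rewrite bD cD be ce eqxx /= -!ltnNge => h1 h2.
by rewrite !inordK // => h; apply: cont_inj; rewrite ?be ?ce.
Qed.

(** A diagonal of a Young diagram is filled from its north-west end, hence it
is known from its number of boxes. *)
Lemma diagP D b : down_closed D -> (b \in D) = (minn b.1 b.2 < diag D (cont b)).
Proof.
move=> clD; apply/idP/idP => [bD|].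
  pose t := minn b.1 b.2.
  have hb1 : t <= b.1 by rewrite geq_minl.
  have hb2 : t <= b.2 by rewrite geq_minr.
  have h1 (i : 'I_t.+1) : b.1 - (t - i) < m by have := ltn_ord b.1; lia.
  have h2 (i : 'I_t.+1) : b.2 - (t - i) < k by have := ltn_ord b.2; lia.
  pose f i : box m k := (Ordinal (h1 i), Ordinal (h2 i)).
  have finj : injective f.
    move=> i j /(congr1 (fun c : box m k => (val c.1, val c.2))) /= [e1 e2].
    by apply: ord_inj; have := ltn_ord i; have := ltn_ord j; lia.
  rewrite -/t -[t.+1]card_ord -(card_imset _ finj); apply: subset_leq_card.
  apply/subsetP => c /imsetP[i _ ->]; rewrite inE; apply/andP; split.
    by apply: clD bD _ _; rewrite /= leq_subr.
  by apply/eqP; rewrite /cont /=; have := ltn_ord i; have := ltn_ord b.1; lia.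
move/diag_exgt => [c [cD ce]] /(cont_le (esym ce)) /andP[h1 h2]; exact: clD cD h1 h2.
Qed.

Lemma diag_inj D E : is_young D -> is_young E -> diag D =1 diag E -> D = E.
Proof.
move=> /youngP yD /youngP yE h; apply/setP => b.
by rewrite (diagP _ yD) (diagP _ yE) h.
Qed.

Lemma cont_gt0 b : 0 < cont b.
Proof. by rewrite /cont; have := ltn_ord b.1; lia. Qed.

Lemma cont_lt b : cont b < k + r.
Proof. by rewrite /cont; have := ltn_ord b.2; lia. Qed.

Lemma diag0 D : diag D 0 = 0.
Proof.
apply/eqP; rewrite cards_eq0; apply/eqP/setP => b; rewrite !inE.
by have := cont_gt0 b; case: eqP => [->|]; rewrite ?andbF.
Qed.

Lemma diag_big D e : k + r <= e -> diag D e = 0.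
Proof.
move=> he; apply/eqP; rewrite cards_eq0; apply/eqP/setP => b; rewrite !inE.
by have := cont_lt b; case: eqP; rewrite ?andbF //; lia.
Qed.

Lemma sum_diag D : \sum_(e < k + r) diag D e = #|D|.
Proof.
rewrite /diag -sum1_card.
rewrite (partition_big (fun b => Ordinal (cont_lt b)) predT) //=.
apply: eq_bigr => e _; rewrite -sum1_card; apply: eq_bigl => b.
by rewrite !inE; congr (_ && _).
Qed.

End Boxes.

(** * Beads on the boundary of a Young diagram *)

Section Beads.
Variables m k r : nat.
Hypothesis hr : m <= r.
Implicit Types (b c d : box m k) (D E S : {set box m k}).

Notation cont := (cont r).
Notation diag := (diag r).

(** The boundary step between the diagonals [p] and [p + 1] is vertical. Diagonals
get longer towards the main one, which has number [r], and shorter after it; the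
term [p < r] makes both cases uniform. *)
Definition bead D (p : nat) : bool := diag D p + (p < r) != diag D p.+1.

Lemma sum_bool_card (I : finType) (P : pred I) : \sum_i (P i : nat) = #|[set i | P i]|.
Proof.
rewrite -sum1_card big_mkcond [RHS]big_mkcond; apply: eq_bigr => i _.
by rewrite inE; case: (P i).
Qed.

Lemma sum_interval (a b N : nat) : \sum_(e < N) (a <= e < b : nat) = minn b N - a.
Proof. elim: N => [|N IHN]; first by rewrite big_ord0; lia. by rewrite big_ord_recr /= IHN;
  lia. Qed.

(** Both sides count the rows whose end lies beyond diagonal [p]: besides the
rows that meet this diagonal in a box of the diagram there are the [r - p] top
rows, which start to the right of it. *)
Lemma diag_diagram la (p : nat) : is_partition la ->
  (forall i, nth 0 la i <= k) -> (forall i, m <= i -> nth 0 la i = 0) ->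
  diag (diagram m k la) p + (r - p) = \sum_(i < r) (p < nth 0 la i + (r - i)).
Proof.
move=> sla hk hm.
have -> : \sum_(i < r) (p < nth 0 la i + (r - i)) =
   \sum_(i < r) ((r <= p + i < nth 0 la i + r) + (i < r - p)).
  by apply: eq_bigr => i _; have := ltn_ord i; lia.
rewrite big_split /=; congr (_ + _); last first.
  by rewrite (sum_bool_card (fun i : 'I_r => i < r - p)) card_ord_lt; lia.
pose F i : nat := r <= p + i < nth 0 la i + r.
have -> : \sum_(i < r) F i = \sum_(i < m) F i.
  rewrite [RHS](big_ord_widen _ F hr) [RHS]big_mkcond; apply: eq_bigr => i _.
  by case: ltnP => // hi; rewrite /F hm //; lia.
rewrite /diag -(sum_bool_card (fun b => (b \in diagram m k la) && (cont b == p))).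
rewrite (eq_bigr (fun b => (((b.1, b.2).2 < nth 0 la (b.1, b.2).1) &&
   (cont (b.1, b.2) == p) : nat))); last by move=> b _; rewrite inE -surjective_pairing.
rewrite -(pair_bigA _ (fun (i : 'I_m) (j : 'I_k) => (((i, j).2 < nth 0 la (i, j).1) &&
   (cont (i, j) == p) : nat))) /=; apply: eq_bigr => i _.
have hi := ltn_ord i; rewrite /F /cont /=.
case: (boolP (r <= p + i < _)) => [h|h]; last first.
  by apply: big1 => j _; apply/eqP; rewrite eqb0; apply/negP => /andP[h1 /eqP h2]; lia.
have hj : p + i - r < k by have := hk i; lia.
rewrite (bigD1 (Ordinal hj)) //= big1 ?addn0.
  by rewrite (_ : (_ && _) = true) //; lia.
move=> j /eqP hne; apply/eqP; rewrite eqb0; apply/negP => /andP[h1 /eqP h2].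
by apply: hne; apply: ord_inj => /=; lia.
Qed.

(** Comparing [diag_diagram] for [p] and [p + 1], the difference counts the rows
that end between the two diagonals. *)
Lemma shifted_parts_diag la (p : nat) : is_partition la ->
  (forall i, nth 0 la i <= k) -> (forall i, m <= i -> nth 0 la i = 0) ->
  (p.+1 \in shifted_parts r la) + diag (diagram m k la) p.+1
    = diag (diagram m k la) p + (p < r).
Proof.
move=> sla hk hm.
have h1 := diag_diagram p sla hk hm; have h2 := diag_diagram p.+1 sla hk hm.
suff h3 : \sum_(i < r) (p < nth 0 la i + (r - i)) =
  \sum_(i < r) (p.+1 < nth 0 la i + (r - i)) + (p.+1 \in shifted_parts r la) by lia.
have usp : uniq (shifted_parts r la).
  rewrite map_inj_in_uniq ?iota_uniq // => i j; rewrite !mem_iota /= => hi hj.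
  by case: (leqP i j) => ij; have := nth_partition sla ij;
    [have := nth_partition sla ij | have := nth_partition sla (ltnW ij)]; lia.
rewrite -(count_uniq_mem _ usp) count_map -sum1_count.
have -> : iota 0 r = index_iota 0 r by rewrite /index_iota subn0.
rewrite big_mkord [X in _ + X]big_mkcond -big_split /=.
by apply: eq_bigr => i _ /=; case: eqP; lia.
Qed.

Lemma beadE D p : is_young D -> bead D p + diag D p.+1 = diag D p + (p < r).
Proof.
move=> /young_diagramP[la [sla hk hm ->]]; rewrite /bead.
have hm' i : m <= i -> nth 0 la i = 0 by move=> hi; rewrite nth_default ?hm.
by have := shifted_parts_diag p sla hk hm'; case: (_ \in _) => /=; lia.
Qed.

Lemma bead_diagram la p : is_partition la ->
  (forall i, nth 0 la i <= k) -> (forall i, m <= i -> nth 0 la i = 0) ->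
  bead (diagram m k la) p = (p.+1 \in shifted_parts r la).
Proof.
move=> sla hk hm; have := shifted_parts_diag p sla hk hm.
by rewrite /bead; case: (_ \in _) => /= <-; lia.
Qed.

Lemma bead_big D p : k + r <= p -> bead D p = false.
Proof. by move=> hp; rewrite /bead !diag_big //; lia. Qed.

Lemma bead_inj D E : is_young D -> is_young E -> bead D =1 bead E -> D = E.
Proof.
move=> yD yE h; apply: (diag_inj (r := r) hr yD yE); elim=> [|p IHp]; first by rewrite !diag0.
by have := beadE p yD; have := beadE p yE; rewrite h IHp; lia.
Qed.

(** ** Ribbons are traces of bead moves *)

(** Among skew shapes this singles out the [n]-ribbons with contents
[p + 1 .. p + n]; see [ribbon_spans] and [spans_ribbon]. The ribbon is then the
trace of a bead that moves between [p] and [p + n]. *)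
Definition spans n S p := forall e : nat, diag S e = (p < e <= p + n).

Lemma spans_cont n S p b : spans n S p -> b \in S -> p < cont b <= p + n.
Proof. by move=> sp bS; have := diag_gt0 r bS; rewrite sp; case: (_ < _ <= _). Qed.

Lemma spans_ex n S p e : spans n S p -> p < e <= p + n -> exists2 b, b \in S & cont b = e.
Proof.
move=> sp he; have /(diag_exgt hr)[b [bS be _]] : 0 < diag S e by rewrite sp he.
by exists b.
Qed.

Lemma diag_le1 S b c : (forall e : nat, diag S e <= 1) ->
  b \in S -> c \in S -> cont b = cont c -> b = c.
Proof.
move=> /(_ (cont c)) /card_le1_eqP h bS cS e; apply: h; rewrite inE ?bS ?cS ?e eqxx //.
Qed.

Lemma spans_inj n S p b c : spans n S p -> b \in S -> c \in S -> cont b = cont c -> b = c.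
Proof. by move=> sp; apply: diag_le1 => e; rewrite sp; case: (_ < _ <= _). Qed.

Lemma spans_uniq n S p p' : 0 < n -> spans n S p -> spans n S p' -> p = p'.
Proof.
move=> hn h1 h2; have e1 := h1 p.+1; have e2 := h1 p'.+1.
by rewrite h2 in e1; rewrite h2 in e2; lia.
Qed.

Section SkewDiag.
Variable S : {set box m k}.
Hypotheses (skS : is_skew S) (S1 : forall e : nat, diag S e <= 1).

(** Otherwise convexity gives a second box on one of the two diagonals. *)
Lemma cont_mono b c : b \in S -> c \in S -> cont b < cont c ->
  (c.1 <= b.1) && (b.2 <= c.2).
Proof.
move=> bS cS h; rewrite /cont in h; have hb := ltn_ord b.1; have hc := ltn_ord c.1.
have hb2 := ltn_ord b.2; have hc2 := ltn_ord c.2.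
apply/andP; split; rewrite leqNgt; apply/negP => lt.
  have h1 : b.1.+1 < m by lia.
  have h2 : b.2.+1 < k by lia.
  have [d d1 d2] := box_ex h1 h2.
  have dS : d \in S by apply: (skew_convex skS bS cS); lia.
  have : b = d by apply: diag_le1 S1 _ _ _ => //; rewrite /cont d1 d2; lia.
  by move=> e; rewrite e in d1; lia.
have h1 : b.1.-1 < m by lia.
have h2 : b.2.-1 < k by lia.
have [d d1 d2] := box_ex h1 h2.
have dS : d \in S by apply: (skew_convex skS cS bS); lia.
have : b = d by apply: diag_le1 S1 _ _ _ => //; rewrite /cont d1 d2; lia.
by move=> e; rewrite -e in d2; lia.
Qed.

Lemma cont_next b c : b \in S -> c \in S -> cont c = (cont b).+1 ->
  (c.1 = b.1 :> nat /\ c.2 = b.2.+1 :> nat) \/ (c.1.+1 = b.1 :> nat /\ c.2 = b.2 :> nat).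
Proof.
move=> bS cS e; have lt : cont b < cont c by lia.
have /andP[h1 h2] := cont_mono bS cS lt; rewrite /cont in e.
have hb := ltn_ord b.1; have hc := ltn_ord c.1.
have hb2 := ltn_ord b.2; have hc2 := ltn_ord c.2.
case: (eqVneq (c.1 : nat) b.1) => c1; first by left; lia.
have h3 : b.1.-1 < m by lia.
have [d d1 d2] := box_ex h3 hb2.
have dS : d \in S by apply: (skew_convex skS _ bS (b := c)) => //; lia.
have : d = c.
  apply: diag_le1 S1 _ _ _ => //; rewrite /cont d1 d2; lia.
by move=> dc; rewrite -dc; right; lia.
Qed.

End SkewDiag.

(** By convexity, two boxes of a skew shape on one diagonal enclose a square. *)
Lemma skew_no_square S : is_skew S -> ~~ has_square S -> forall e : nat, diag S e <= 1.
Proof.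
move=> skS nsq e.
suff H b c : b \in S -> c \in S -> cont b = e -> cont c = e -> b.1 <= c.1 -> b = c.
  apply/card_le1_eqP => b c; rewrite !inE => /andP[bS /eqP be] /andP[cS /eqP ce].
  by case: (leqP b.1 c.1) => [|/ltnW] h; [apply/esym|]; apply: H.
move=> bS cS be ce; rewrite leq_eqVlt => /orP[/eqP h|lt].
  by have hb := ltn_ord b.1; rewrite /cont in be ce; apply: box_eq; lia.
have hb := ltn_ord b.1; have hc := ltn_ord c.1; have hc2 := ltn_ord c.2.
rewrite /cont in be ce.
have h1 : b.1.+1 < m by lia.
have h2 : b.2.+1 < k by lia.
have [d d1 d2] := box_ex h1 h2.
have inS b' : b.1 <= b'.1 -> b.2 <= b'.2 -> b'.1 <= d.1 -> b'.2 <= d.2 -> b' \in S.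
  by move=> *; apply: (skew_convex skS bS cS); lia.
case/negP: nsq; apply/exists_inP; exists b => //; apply/exists_inP; exists d.
  by apply: inS; lia.
by rewrite d1 d2 !eqxx /=; apply/andP; split; apply: inS; rewrite /= ?d1 ?d2; lia.
Qed.

Lemma adjacentC b c : adjacent b c = adjacent c b.
Proof.
rewrite /adjacent (eq_sym b.1) (eq_sym b.2).
by congr ((_ && _) || (_ && _)); exact: orbC.
Qed.

Lemma adjacent_cont b c : adjacent b c -> (cont c <= (cont b).+1) && (cont b <= (cont c).+1).
Proof.
have hb := ltn_ord b.1; have hc := ltn_ord c.1; rewrite /adjacent /cont.
by case/orP => /andP[/eqP e] /orP[] /eqP e'; rewrite ?e; lia.
Qed.

(** Contents of adjacent boxes differ by one, so they take intermediate values. *)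
Lemma connected_cont S b c e : connected S -> b \in S -> c \in S ->
  cont b <= e <= cont c -> exists2 d, d \in S & cont d = e.
Proof.
move=> /forall_inP cS bS cS' /andP[be ec].
have /forall_inP /(_ c cS') /connectP[p pth lst] := cS b bS.
elim: p b bS be pth lst => [|d p IHp] b bS be /=.
  by move=> _ cb; exists b => //; rewrite cb in ec; lia.
case/andP => /and3P[_ dS /adjacent_cont adj] pth lst.
case: (ltngtP (cont b) e) => h; first by apply: (IHp d) => //; lia.
  by lia.
by exists b.
Qed.

Lemma ribbon_spans n S : 0 < n -> is_ribbon n S -> exists p, spans n S p.
Proof.
move=> hn /and4P[skS cnS /eqP cdS nsq].
have S1 := skew_no_square skS nsq.
have [b0 b0S] : exists b, b \in S by apply/card_gt0P; rewrite cdS.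
have [lo loS lomin] := arg_minnP (fun b => cont b) b0S.
have [hi hiS himax] := arg_maxnP (fun b => cont b) b0S.
have dg e : diag S e = (cont lo <= e <= cont hi).
  case: (boolP (_ <= _ <= _)) => h.
    have [b bS be] := connected_cont cnS loS hiS h.
    by have := S1 e; have := diag_gt0 r bS; rewrite be; lia.
  apply/eqP; rewrite cards_eq0; apply/eqP/setP => b; rewrite !inE.
  apply/negP => /andP[bS /eqP be]; have := lomin b bS; have := himax b bS.
  by rewrite -be in h; rewrite /=; lia.
have lo0 := cont_gt0 hr lo; have hib := cont_lt hr hi; have lohi := lomin hi hiS.
have : n = (cont hi).+1 - cont lo.
  rewrite -cdS -(sum_diag hr) (eq_bigr (fun e : 'I_(k + r) => (cont lo <= e < (cont hi).+1) : nat)).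
    by rewrite sum_interval; lia.
  by move=> e _; rewrite dg.
move=> en; exists (cont lo).-1 => e; rewrite dg; congr (nat_of_bool _); lia.
Qed.

Lemma spans_ribbon n S p : is_skew S -> spans n S p -> p + n < k + r -> is_ribbon n S.
Proof.
move=> skS sp hpn; have S1 e : diag S e <= 1 by rewrite sp; case: (_ < _ <= _).
apply/and4P; split => //.
- pose R := fun u v : box m k => [&& u \in S, v \in S & adjacent u v].
  have Rsym : symmetric R.
    by move=> u v; rewrite /R adjacentC; do 2!case: (_ \in S).
  have H x b c : b \in S -> c \in S -> cont c = cont b + x -> connect R b c.
    elim: x b c => [|x IHx] b c bS cS e.
      by rewrite (spans_inj sp bS cS) ?connect0 // e addn0.
    have hb := spans_cont sp bS; have hc := spans_cont sp cS.
    have he : p < cont b + x <= p + n by lia.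
    have [d dS de] := spans_ex sp he.
    apply: (connect_trans (IHx b d bS dS de)); apply: connect1.
    rewrite /R dS cS /=.
    have /(cont_next skS S1 dS cS) : cont c = (cont d).+1 by lia.
    rewrite /adjacent -!val_eqE /= => -[[-> ->]|[<- ->]]; rewrite !eqxx ?orbT //.
  apply/forall_inP => b bS; apply/forall_inP => c cS; rewrite -/R.
  case: (leqP (cont b) (cont c)) => h.
    by apply: (H (cont c - cont b)) => //; lia.
  rewrite (sym_connect_sym Rsym).
  by apply: (H (cont b - cont c)) => //; lia.
- rewrite -(sum_diag hr) (eq_bigr (fun e : 'I_(k + r) => (p.+1 <= e < (p + n).+1) : nat));
  last first.
    by move=> e _; rewrite sp.
  by rewrite sum_interval; apply/eqP; lia.
apply/negP => /exists_inP[b bS /exists_inP[c cS /and4P[/eqP h1 /eqP h2 _ _]]].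
have : b = c.
  by apply: (spans_inj sp bS cS); rewrite /cont h1 h2 addSn subSS.
by move=> e; rewrite e in h1; lia.
Qed.

End Beads.

(** * Removing a ribbon from a Young diagram *)

Section Removal.
Variables m k r : nat.
Hypothesis hr : m <= r.
Implicit Types (b c d : box m k) (D E S : {set box m k}).

Notation cont := (cont r).
Notation diag := (diag r).
Notation bead := (bead r).
Notation spans := (spans r).

(** The diagonals [p + 1 .. p + n] lose one box each, so that only the boundary
steps at [p] and [p + n] change. *)
Lemma bead_move n D S p q : 0 < n -> is_young D -> is_young (D :\: S) -> S \subset D ->
  spans n S p -> bead D q + (q == p) = bead (D :\: S) q + (q == p + n).
Proof.
move=> hn yD yDS sub sp; have h1 := beadE hr q yD; have h2 := beadE hr q yDS.
have h3 := diagD r q sub; have h4 := diagD r q.+1 sub; rewrite !sp in h3 h4.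
by case: (bead D q) (bead _ q) h1 h2 => -[] /=; lia.
Qed.

(** For boxes of a Young diagram this says being the last one on its diagonal. *)
Definition rim_box D b : bool := (minn b.1 b.2).+1 == diag D (cont b).

Definition rim n D p := [set b in D | (p < cont b <= p + n) && rim_box D b].

Lemma rim_sub n D p : rim n D p \subset D.
Proof. by apply/subsetP => b; rewrite inE => /andP[]. Qed.

(** What remains is a Young diagram, so each diagonal loses its last box. *)
Lemma removable_rim n D S p : is_young D -> is_young (D :\: S) -> S \subset D ->
  spans n S p -> S = rim n D p.
Proof.
move=> /youngP yD /youngP yDS sub sp; apply/setP => b; rewrite inE.
have h := diagD r (cont b) sub; rewrite sp in h.
have bD := diagP hr b yD; have bDS := diagP hr b yDS.
rewrite inE in bDS; case bS: (b \in S).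
  have := spans_cont sp bS; have bD' := subsetP sub b bS; rewrite bD' in bD.
  rewrite bS /= in bDS; rewrite bD' => hb; rewrite hb in h *.
  move/esym: bD => bD; move/esym/negbT: bDS => bDS; rewrite andTb.
  by apply/esym/eqP; lia.
apply/esym/negP => /andP[bD' /andP[h1 /eqP h2]].
by rewrite h1 in h; rewrite bS bD' /= in bDS; lia.
Qed.

(** From an empty diagonal on, outwards from the main one, all diagonals are
empty and the boundary runs straight: only gaps to the north-east, only beads to
the south-west. *)
Lemma bead_diag_gt0 n D p e : is_young D -> bead D (p + n) -> ~~ bead D p ->
  p < e <= p + n -> 0 < diag D e.
Proof.
move=> yD b1 b0 he; rewrite lt0n; apply/eqP => d0.
case: (leqP r e) => her.
  have H x : diag D (e + x) = 0.
    elim: x => [|x IHx]; first by rewrite addn0.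
    by rewrite addnS; have := beadE hr (e + x) yD; rewrite IHx; lia.
  have := beadE hr (p + n) yD; rewrite b1.
  by have := H (p + n - e); rewrite (_ : e + _ = p + n); [lia | lia].
have H x : x <= e -> diag D (e - x) = 0.
  elim: x => [|x IHx] hx; first by rewrite subn0.
  have := beadE hr (e - x.+1) yD.
  rewrite (_ : (e - x.+1).+1 = e - x); last by lia.
  by rewrite IHx; [case: (bead D _) => /=; lia | lia].
have := beadE hr p yD; rewrite (negbTE b0).
have := H (e - p); rewrite (_ : e - (e - p) = p); last by lia.
have := H (e - p.+1); rewrite (_ : e - (e - p.+1) = p.+1); last by lia.
by lia.
Qed.

Lemma rim_spans n D p : is_young D -> bead D (p + n) -> ~~ bead D p ->
  spans n (rim n D p) p.
Proof.
move=> yD b1 b0 e; case: (boolP (p < e <= p + n)) => he; last first.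
  apply/eqP; rewrite cards_eq0; apply/eqP/setP => b; rewrite !inE.
  by apply/negP => /andP[/andP[_ /andP[h _]] /eqP be]; rewrite be in h; rewrite h in he.
have d0 := bead_diag_gt0 yD b1 b0 he.
have lt : (diag D e).-1 < diag D e by lia.
have [b [bD be hb]] := diag_exgt hr lt.
have := diagP hr b (youngP _ yD); rewrite bD be => /esym hb2.
apply/eqP/cards1P; exists b; apply/setP => c; rewrite !inE.
apply/andP/eqP => [[/andP[_ /andP[_ /eqP h]] /eqP ce]|->].
  by apply: (cont_inj hr); rewrite ?ce ?be //; rewrite ce in h; lia.
by rewrite /rim_box bD be he eqxx /=; split=> //; apply/eqP; lia.
Qed.

Lemma rimP D b : is_young D -> b \in D ->
  reflect (forall c, c \in D -> ~~ ((b.1 < c.1) && (b.2 < c.2)))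
          (rim_box D b).
Proof.
move=> /youngP yD bD; have hb := diagP hr b yD; rewrite bD in hb.
have hb1 := ltn_ord b.1; have hb2 := ltn_ord b.2.
apply: (iffP eqP) => [e c cD|H].
  apply/negP => /andP[c1 c2].
  have hc1 := ltn_ord c.1; have hc2 := ltn_ord c.2.
  have h1 : b.1.+1 < m by lia.
  have h2 : b.2.+1 < k by lia.
  have [d d1 d2] := box_ex h1 h2.
  have dD : d \in D by apply: (yD c) => //; lia.
  have := diagP hr d yD; rewrite dD.
  by rewrite (_ : cont d = cont b); [rewrite d1 d2; lia | rewrite /cont; lia].
apply/eqP; rewrite eqn_leq -hb andTb leqNgt; apply/negP => /(diag_exgt hr)[c [cD ce hc]].
have := H c cD; rewrite /cont in ce; have hc1 := ltn_ord c.1; have hc2 := ltn_ord c.2; lia.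
Qed.

(** The box east of [b] would lie on the next diagonal, whose length is known from
the boundary step in between. *)
Lemma bead_row_end D b : is_young D -> b \in D ->
  rim_box D b ->
  reflect (forall c, c \in D -> c.1 = b.1 -> c.2 <= b.2) (bead D (cont b)).
Proof.
move=> yD' bD /eqP lst; have yD := youngP _ yD'; have hbd := beadE hr (cont b) yD'.
have hb1 := ltn_ord b.1; have hb2 := ltn_ord b.2.
have hlt : (cont b < r) = (b.2 < b.1) by rewrite /cont; lia.
rewrite hlt in hbd.
apply: (iffP idP) => [bb c cD c1|H].
  rewrite leqNgt; apply/negP => c2; have hc2 := ltn_ord c.2.
  have h2 : b.2.+1 < k by lia.
  have [d d1 d2] := box_ex hb1 h2.
  have dD : d \in D by apply: (yD c) => //; rewrite ?c1; lia.
  have := diagP hr d yD; rewrite dD (_ : cont d = (cont b).+1); last by rewrite /cont; lia.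
  by rewrite bb in hbd; rewrite d1 d2; lia.
apply: contraT => nb; rewrite (negbTE nb) in hbd.
have lt : minn b.1 b.2.+1 < diag D (cont b).+1 by lia.
have [d [dD de hd]] := diag_exgt hr lt.
have hd1 := ltn_ord d.1; have hd2 := ltn_ord d.2; rewrite /cont in de.
have h2 : b.2.+1 < k by lia.
have [c c1 c2] := box_ex hb1 h2.
have cD : c \in D by apply: (yD d) => //; lia.
by have := H c cD (ord_inj c1); lia.
Qed.

(** Likewise, the box south of [b] would lie on the previous diagonal. *)
Lemma bead_col_end D b c : is_young D -> b \in D ->
  rim_box D b -> ~~ bead D (cont b).-1 ->
  c \in D -> c.2 = b.2 -> c.1 <= b.1.
Proof.
move=> yD' bD /eqP lst nb cD c2; have yD := youngP _ yD'.
have hb1 := ltn_ord b.1; have hb2 := ltn_ord b.2.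
have hbd := beadE hr (cont b).-1 yD'; rewrite prednK ?(cont_gt0 hr) // (negbTE nb) in hbd.
have hlt : (cont b <= r) = (b.2 <= b.1) by rewrite /cont; lia.
rewrite hlt in hbd.
rewrite leqNgt; apply/negP => c1; have hc1 := ltn_ord c.1.
have h1 : b.1.+1 < m by lia.
have [d d1 d2] := box_ex h1 hb2.
have dD : d \in D by apply: (yD c) => //; rewrite ?c2; lia.
have := diagP hr d yD; rewrite dD (_ : cont d = (cont b).-1); last by rewrite /cont; lia.
by rewrite d1 d2; lia.
Qed.

(** A box of the rim may be removed unless the diagram continues east or south of
it outside the segment; the bead at [p + n] and the gap at [p] exclude this at the
two ends of the segment. *)
Lemma rim_removable n D p : is_young D -> bead D (p + n) -> ~~ bead D p ->
  is_young (D :\: rim n D p).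
Proof.
move=> yD b1 b0; have clD := youngP _ yD.
apply/youngP => b c; rewrite inE => /andP[bS bD] c1 c2.
have cD := clD _ _ bD c1 c2; rewrite inE cD andbT; apply/negP => cS.
have lastS d : d \in D -> c.1 <= d.1 -> c.2 <= d.2 -> rim_box D d.
  move=> dD d1 d2; apply/(rimP yD dD) => e eD.
  move: cS; rewrite inE => /and3P[_ _ /(rimP yD cD) /(_ e eD)]; lia.
have notS d : d \in D -> c.1 <= d.1 -> c.2 <= d.2 -> d \notin rim n D p ->
    ~~ (p < cont d <= p + n).
  by move=> dD d1 d2; apply: contra => h; rewrite inE dD h lastS.
have hc : p < cont c <= p + n by move: cS; rewrite inE => /and3P[].
have hbn := notS b bD c1 c2 bS.
have := notS b bD c1 c2 bS; move: cS; rewrite inE => /and3P[_ _ /(rimP yD cD) /(_ b bD)].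
have hb1 := ltn_ord b.1; have hb2 := ltn_ord b.2; have hc1 := ltn_ord c.1;
  have hc2 := ltn_ord c.2.
rewrite negb_and -!leqNgt => /orP[] h _; rewrite /cont in hbn hc.
  have h2 : p + n + c.1 - r < k by lia.
  have [d d1 d2] := box_ex hc1 h2.
  have dD : d \in D by apply: (clD b) => //; lia.
  have cd : cont d = p + n by rewrite /cont; lia.
  have dl : rim_box D d by apply: lastS => //; lia.
  have e : b.1 = d.1 by apply: ord_inj; lia.
  have := elimT (bead_row_end yD dD dl); rewrite cd => /(_ b1 b bD e).
  by lia.
have h1 : c.2 + r - p.+1 < m by lia.
have [d d1 d2] := box_ex h1 hc2.
have dD : d \in D by apply: (clD b) => //; lia.
have cd : cont d = p.+1 by rewrite /cont; lia.
have dl : rim_box D d by apply: lastS => //; lia.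
have e : b.2 = d.2 by apply: ord_inj; lia.
have := bead_col_end yD dD dl; rewrite cd => /(_ b b0 bD e).
by lia.
Qed.

Lemma sum_window N a n (f : nat -> nat) : a + n <= N ->
  \sum_(e < N) (a <= e < a + n) * f e = \sum_(d < n) f (a + d).
Proof.
elim: n => [|n IHn] han.
  by rewrite big_ord0 big1 // => e _; rewrite (_ : _ && _ = false) //; lia.
rewrite big_ord_recr /= -IHn; last by lia.
have lt : a + n < N by lia.
rewrite (bigD1 (Ordinal lt)) //= [in RHS](bigD1 (Ordinal lt)) //=.
rewrite (_ : (a <= a + n < a + n.+1) = true); last by lia.
rewrite (_ : (a <= a + n < a + n) = false); last by lia.
rewrite mul1n mul0n add0n addnC; congr (_ + _); apply: eq_bigr => e /eqP ne.
have ne' : e <> a + n :> nat by move=> h; apply: ne; apply: ord_inj.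
by congr (nat_of_bool _ * _); lia.
Qed.

(** Every row of a removable ribbon ends in exactly one box of the boundary,
where the boundary runs along its east side. *)
Lemma ribbon_spin_beads n D S p : 0 < n -> is_young D -> is_young (D :\: S) -> S \subset D ->
  spans n S p -> ribbon_spin S = \sum_(d < n.-1) bead D (p + d.+1).
Proof.
move=> hn yD yDS sub sp; have Srim := removable_rim yD yDS sub sp.
have clD := youngP _ yD; have clDS := youngP _ yDS.
have [b0 b0S b0e] : exists2 b, b \in S & cont b = p + n by apply: (spans_ex hr sp); lia.
pose S' := [set b in S | bead D (cont b)].
have lastS b : b \in S -> rim_box D b.
  by rewrite Srim inE => /and3P[].
have rowS : [set b.1 | b in S] = [set b.1 | b in S'].
  apply/setP => i; apply/imsetP/imsetP => [[b bS ->]|[b]]; last first.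
    by rewrite inE => /andP[bS _] ->; exists b.
  have bD := subsetP sub b bS.
  have Pb : (b \in D) && (b.1 == b.1) by rewrite bD eqxx.
  have [c /andP[cD /eqP c1] cmax] := @arg_maxnP _ b (fun c => (c \in D) && (c.1 == b.1)) (fun c => c.2 : nat) Pb.
  have bc := cmax b Pb.
  have cS : c \in S.
    apply: contraT => cS; have cDS : c \in D :\: S by rewrite inE cS.
    by have := clDS c b cDS; rewrite c1 leqnn inE bS => /(_ isT bc).
  exists c => //; rewrite inE cS; apply/(bead_row_end yD cD (lastS c cS)) => d dD d1.
  by apply: cmax; rewrite dD d1 c1 eqxx.
have cardS : #|[set b.1 | b in S]| = #|S'|.
  rewrite rowS card_in_imset // => b c; rewrite !inE => /andP[bS bb] /andP[cS bc] e.
  have bD := subsetP sub b bS; have cD := subsetP sub c cS.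
  apply: box_eq; first by rewrite e.
  apply/eqP; rewrite eqn_leq (elimT (bead_row_end yD cD (lastS c cS)) bc b bD e).
  by rewrite (elimT (bead_row_end yD bD (lastS b bS)) bb c cD (esym e)).
have hpn : p + n < k + r by rewrite -b0e (cont_lt hr).
rewrite /ribbon_spin cardS -(sum_diag hr).
rewrite (eq_bigr (fun e : 'I_(k + r) => (p.+1 <= e < p.+1 + n) * bead D e)); last first.
  move=> e _; rewrite addSn ltnS -sp /diag; case bb: (bead D e).
    rewrite muln1; apply: eq_card => b; rewrite !inE.
    by case: (b \in S) => //=; case: eqP => [->|]; rewrite ?bb ?andbF.
  rewrite muln0; apply/eqP; rewrite cards_eq0; apply/eqP/setP => b; rewrite !inE.
  by apply/negP => /andP[/andP[_ h] /eqP e0]; rewrite e0 bb in h.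
rewrite (@sum_window _ p.+1 n (fun e => bead D e : nat)); last by lia.
rewrite -[in LHS](prednK hn) big_ord_recr /=.
have -> : bead D (p.+1 + n.-1).
  rewrite (_ : p.+1 + n.-1 = p + n); last by lia.
  by have := bead_move (p + n) hn yD yDS sub sp; rewrite eqxx; case: (bead D _) => //; lia.
by rewrite addn1 /=; apply: eq_bigr => d _; rewrite addSnnS.
Qed.

End Removal.

(** * Reflection in the main diagonal *)

Section Reflection.
Variables m k : nat.
Implicit Types (b c d : box m k) (D E S : {set box m k}) (P : {set {set box m k}}).

Lemma in_reflect D (c : box k m) : (c \in reflect_shape D) = (reflect_box c \in D).
Proof.
apply/imsetP/idP => [[b bD ->]|cD]; first by case: b bD.
by exists (reflect_box c) => //; case: c cD.
Qed.

Lemma reflect_shapeD D E : reflect_shape (D :\: E) = reflect_shape D :\: reflect_shape E.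
Proof. by apply/setP => c; rewrite !(in_reflect, inE). Qed.

Lemma reflect_sub D E : D \subset E -> reflect_shape D \subset reflect_shape E.
Proof. by move=> /subsetP s; apply/subsetP => c; rewrite !in_reflect => /s. Qed.

End Reflection.

Lemma reflect_shapeK m k : cancel (@reflect_shape m k) (@reflect_shape k m).
Proof. by move=> D; apply/setP => -[i j]; rewrite !in_reflect. Qed.

Lemma reflect_tilingK m k : cancel (@reflect_tiling m k) (@reflect_tiling k m).
Proof.
move=> P; rewrite /reflect_tiling -imset_comp -[RHS]imset_id.
by apply: eq_imset => S; rewrite /= reflect_shapeK.
Qed.

Lemma young_reflect m k (D : {set box m k}) : is_young (reflect_shape D) = is_young D.
Proof.
wlog suff H : m k D / is_young D -> is_young (reflect_shape D).
  by apply/idP/idP => [/H|/H//]; rewrite reflect_shapeK.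
by move/youngP => yD; apply/youngP => b c; rewrite !in_reflect => bD h1 h2; apply: yD bD _ _.
Qed.

Section ReflectDiag.
Variables m k r K : nat.
Hypotheses (hr : m <= r) (hK : k <= K).
Implicit Types (D S : {set box m k}).

Lemma cont_reflect (b : box m k) : cont K (reflect_box b) + cont r b = K + r.
Proof. by case: b => i j; rewrite /cont /=; have := ltn_ord i; have := ltn_ord j; lia. Qed.

Lemma diag_reflect D e : e <= K + r -> diag K (reflect_shape D) e = diag r D (K + r - e).
Proof.
move=> he; rewrite /diag -[RHS](@card_imset _ _ (@reflect_box m k)); last first.
  by move=> [i j] [i' j'] [-> ->].
apply: eq_card => c; rewrite inE in_reflect; apply/andP/imsetP => [[cD /eqP ce]|[b]].
  have rc : reflect_box (reflect_box c) = c by case: (c).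
  exists (reflect_box c); last by rewrite rc.
  by rewrite inE cD; apply/eqP; have := cont_reflect (reflect_box c); rewrite rc ce; lia.
rewrite inE => /andP[bD /eqP be] ->; split; first by case: (b) bD.
by apply/eqP; have := cont_reflect b; rewrite be; lia.
Qed.

(** The boundary path is traversed backwards, and its vertical and horizontal
steps are exchanged. *)
Lemma bead_reflect D q : is_young D -> q < K + r ->
  bead K (reflect_shape D) q = ~~ bead r D (K + r - q.+1).
Proof.
move=> yD hq; have yR : is_young (reflect_shape D) by rewrite young_reflect.
have := beadE hK q yR; have := beadE hr (K + r - q.+1) yD.
rewrite !diag_reflect; [|lia|lia].
rewrite (_ : (K + r - q.+1).+1 = K + r - q); last by lia.
by case: (bead r D _) (bead K _ _) => -[] /=; lia.
Qed.

Lemma spans_reflect n S p : 0 < n -> p + n < K + r -> spans r n S p ->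
  spans K n (reflect_shape S) (K + r - (p + n).+1).
Proof.
move=> hn hp sp e; case: (leqP e (K + r)) => he.
  by rewrite diag_reflect // sp; congr nat_of_bool; lia.
by rewrite diag_big //; lia.
Qed.

End ReflectDiag.

(** * Horizontal strips as sets of bead moves *)

Definition arrives n (L : pred nat) q : bool := (n <= q) && L (q - n).

(** This is both the effect of bead moves and the conservation of particles at
each vertex of a row of the lattice. *)
Definition conserves n (V V' L : pred nat) := forall q, V' q + L q = V q + arrives n L q.

Definition collision_free n (V L : pred nat) := forall q, ~~ (V q && arrives n L q).

(** For a ribbon, the toll at a place below the flight is the weight of an
additional row or of an additional column. *)
Definition launch_weight (R : comNzRingType) n M (L : pred nat) (a : nat -> R) (x : R) : R :=
  (\prod_(c < M | L c) (x * \prod_(d < n.-1) a (c + d.+1)%N))%R.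

Lemma eq_launch_weight (R : comNzRingType) n M (L L' : pred nat) (a : nat -> R) x :
  L =1 L' -> launch_weight n M L a x = launch_weight n M L' a x.
Proof. by move=> e; apply: eq_bigl => c. Qed.

(** Arrivals at [q] are launches [n] places before, so launches are determined
from left to right. *)
Lemma launches_uniq n V V' L1 L2 : 0 < n ->
  conserves n V V' L1 -> conserves n V V' L2 -> L1 =1 L2.
Proof.
move=> hn h1 h2 q; have [N] := ubnP q; elim: N q => // N IHN q hq.
have e : arrives n L1 q = arrives n L2 q.
  by rewrite /arrives; case: leqP => //= hnq; apply: IHN; lia.
by have := h1 q; have := h2 q; rewrite e; case: (L1 q) (L2 q) => -[]; lia.
Qed.

Lemma prod_if (R : comNzRingType) (q t : R) N (f : nat -> bool) :
  (\prod_(d < N) (if f d then q else t) =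
   q ^+ (\sum_(d < N) f d) * t ^+ (\sum_(d < N) ~~ f d))%R.
Proof.
elim: N => [|N IHN]; first by rewrite !big_ord0 !expr0 mulr1.
rewrite !big_ord_recr /= IHN; case: (f N) => /=.
  by rewrite addn1 addn0 exprSr -!mulrA [(_ * q)%R]mulrC.
by rewrite addn1 addn0 exprSr mulrA.
Qed.

Section Strips.
Variables m k r n : nat.
Hypotheses (hr : m <= r) (hn : 0 < n).
Implicit Types (b c d : box m k) (D E S : {set box m k}) (P : {set {set box m k}}).

Notation cont := (cont r).
Notation bead := (bead r).
Notation spans := (spans r n).

Lemma top_right_cont S p b : is_skew S -> spans S p ->
  top_right_most S b = (b \in S) && (cont b == p + n).
Proof.
move=> skS sp; rewrite /top_right_most; case bS: (b \in S) => //=.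
have S1 e : diag r S e <= 1 by rewrite sp; case: (_ < _ <= _).
have hb := spans_cont sp bS; have hb1 := ltn_ord b.1.
apply/forall_inP/eqP => [H|be c cS].
  have [h hS he] : exists2 b, b \in S & cont b = p + n by apply: (spans_ex hr sp); lia.
  by have /andP[] := H h hS; have h1 := ltn_ord h.1; rewrite /cont in he hb *; lia.
have hc := spans_cont sp cS; case: (ltngtP (cont c) (cont b)) => h; last 1 first.
- by rewrite (spans_inj sp cS bS h) !leqnn.
- exact: (cont_mono hr skS S1 cS bS h).
- by lia.
Qed.

Lemma strip_ribbon F P S : horizontal_strip n F P -> S \in P -> is_ribbon n S.
Proof. by case/andP => /and3P[_ _ /forall_inP h] _ /h. Qed.

Lemma strip_partition F P : horizontal_strip n F P -> partition P F.
Proof. by case/andP => /and3P[]. Qed.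

Lemma strip_touches F P S p b c : horizontal_strip n F P -> S \in P -> spans S p ->
  b \in S -> cont b = p + n -> c \in F -> c.1.+1 = b.1 :> nat -> c.2 = b.2 :> nat -> False.
Proof.
move=> hP SP sp bS be cF c1 c2; have /and4P[skS _ _ _] := strip_ribbon hP SP.
have /forall_inP /(_ S SP) /forallP /(_ b) := proj2 (andP hP).
rewrite (top_right_cont b skS sp) bS be eqxx /= => /negP; apply.
by apply/exists_inP; exists c => //; rewrite c1 eqxx /= -val_eqE /= c2.
Qed.

Lemma strip_in F P b : horizontal_strip n F P -> b \in F -> exists2 S, S \in P & b \in S.
Proof.
move=> /strip_partition /and3P[/eqP <- _ _] /bigcupP[S SP bS]; by exists S.
Qed.

Lemma strip_sub F P S : horizontal_strip n F P -> S \in P -> S \subset F.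
Proof. by move=> /strip_partition /and3P[/eqP <- _ _] SP; apply: bigcup_sup. Qed.

Lemma strip_disjoint F P S S' b : horizontal_strip n F P -> S \in P -> S' \in P ->
  b \in S -> b \in S' -> S = S'.
Proof.
move=> /strip_partition /and3P[_ tI _] SP S'P bS bS'.
by rewrite -(def_pblock tI SP bS) -(def_pblock tI S'P bS').
Qed.

Section TwoShapes.
Variables E D : {set box m k}.
Hypotheses (yE : is_young E) (yD : is_young D).
Notation HS := (horizontal_strip n (D :\: E)).

(** Going north-east along two ribbons of a horizontal strip, one that lies to
the south-east of the other stays there; at its head, the box above would
belong to the strip. *)
Lemma strip_noncrossing P S S' p p' b c : HS P -> S \in P -> S' \in P -> S <> S' ->
  spans S p -> spans S' p' -> p' <= p -> c \in S -> b \in S' ->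
  c.1 <= b.1 -> c.2 <= b.2 -> False.
Proof.
move=> hP SP S'P neq sp sp' hp.
have clE := youngP _ yE; have clD := youngP _ yD.
have /and4P[skS _ _ _] := strip_ribbon hP SP.
have /and4P[skS' _ _ _] := strip_ribbon hP S'P.
have S1 (e : nat) : diag r S e <= 1 by rewrite sp; case: (_ < _ <= _).
have S'1 (e : nat) : diag r S' e <= 1 by rewrite sp'; case: (_ < _ <= _).
have SF := subsetP (strip_sub hP SP); have S'F := subsetP (strip_sub hP S'P).
have [N] : exists N, p + p' + 2 * n < N + cont b + cont c.
  by exists (p + p' + 2 * n).+1; clear; lia.
elim: N b c => [|N IHN] b c hN cS bS' c1 c2.
  by have := spans_cont sp cS; have := spans_cont sp' bS'; clear -hN; lia.
have neqb : c <> b by move=> e; apply: neq; apply: (strip_disjoint hP SP S'P cS); rewrite e.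
have nxt d T t : is_skew T -> (forall e : nat, diag r T e <= 1) -> spans T t -> d \in T ->
    cont d < t + n -> exists d', [/\ d' \in T, cont d' = (cont d).+1 &
     (d'.1 = d.1 :> nat /\ d'.2 = d.2.+1 :> nat) \/ (d'.1.+1 = d.1 :> nat /\ d'.2 = d.2 :> nat)].
  move=> skT T1 st dT hd; have /andP[hd' _] := spans_cont st dT.
  have [d'' d''T e] : exists2 b, b \in T & cont b = (cont d).+1.
    by apply: (spans_ex hr st); rewrite hd (leq_trans hd').
  by exists d''; split => //; apply: (cont_next hr skT T1 dT d''T e).
have head d : d \in S -> d.1 < b.1 -> d.2 <= b.2 -> cont b = p' + n -> False.
  (* the box above the head of [S'] is weakly south-east of [d] *)
  move=> dS d1 d2 hb'.
  have h1 : b.1.-1 < m by apply: leq_ltn_trans (leq_pred _) (ltn_ord _).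
  have [u u1 u2] := box_ex h1 (ltn_ord b.2).
  have u1' : u.1.+1 = b.1 :> nat by rewrite u1; case: (b.1 : nat) d1.
  apply: (strip_touches hP S'P sp' bS' hb' (c := u)) => //.
  have := S'F b bS'; have := SF d dS; rewrite !inE => /andP[dE _] /andP[_ bD].
  rewrite (clD b) //; [|by rewrite u1 leq_pred|by rewrite u2]; rewrite andbT.
  apply: contra dE => uE; apply: (clE u) => //; last by rewrite u2.
  by rewrite -ltnS u1'.
have hb' : cont b <= p' + n by have /andP[] := spans_cont sp' bS'.
move: hb'; rewrite leq_eqVlt => /orP[/eqP hb'|/(nxt b S' p' skS' S'1 sp' bS')].
  case: (ltnP c.1 b.1) => lt1; first exact: (head c).
  (* same row: [c] is strictly to the left of [b] and is not the head of [S] *)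
  have e1 : c.1 = b.1 :> nat by apply/eqP; rewrite eqn_leq c1.
  have lt2 : c.2 < b.2.
    rewrite ltn_neqAle c2 andbT; apply/eqP => e2; apply: neqb; exact: box_eq.
  have ltc : cont c < p + n.
    by have := contE hr b; have := contE hr c; clear -e1 lt2 hb' hp; lia.
  have [d [dS de [[d1 d2]|[d1 d2]]]] := nxt c S p skS S1 sp cS ltc.
    by apply: (IHN b d) => //; clear -hN de d1 d2 e1 lt2; lia.
  by apply: (head d) => //; clear -d1 d2 e1 c2; lia.
move=> [d' [dS' de' [[d1' d2']|[d1' d2']]]].
  by apply: (IHN d' c) => //; clear -hN de' d1' d2' c1 c2; lia.
case: (ltnP c.1 b.1) => lt1; first by apply: (IHN d' c) => //; clear -hN de' d1' d2' lt1 c2; lia.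
have e1 : c.1 = b.1 :> nat by apply/eqP; rewrite eqn_leq c1.
have lt2 : c.2 < b.2.
  rewrite ltn_neqAle c2 andbT; apply/eqP => e2; apply: neqb; exact: box_eq.
have ltc : cont c < p + n.
  have := contE hr b; have := contE hr c; have /andP[_] := spans_cont sp' bS'.
  by clear -e1 lt2 hp; lia.
have [d [dS de [[d1 d2]|[d1 d2]]]] := nxt c S p skS S1 sp cS ltc.
  by apply: (IHN b d) => //; clear -hN de d1 d2 e1 lt2; lia.
by apply: (IHN d' d) => //; clear -hN de de' d1 d2 d1' d2' e1 c2; lia.
Qed.

Lemma strip_last_removable P S p : HS P -> S \in P -> spans S p ->
  (forall S' p', S' \in P -> spans S' p' -> p' <= p) -> is_young (D :\: S).
Proof.
move=> hP SP sp mx; apply/youngP => b c; rewrite !inE => /andP[bS bD] c1 c2.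
rewrite (youngP _ yD b c bD c1 c2) andbT; apply/negP => cS.
have := subsetP (strip_sub hP SP) c cS; rewrite inE => /andP[cE _].
have bF : b \in D :\: E.
  by rewrite inE bD andbT; apply: contra cE => bE; apply: (youngP _ yE b).
have [S' S'P bS'] := strip_in hP bF.
have [p' sp'] := ribbon_spans hr hn (strip_ribbon hP S'P).
apply: (strip_noncrossing hP SP S'P _ sp sp' (mx _ _ S'P sp') cS bS' c1 c2).
by move=> e; rewrite e bS' in bS.
Qed.

(** The two heads are on one diagonal, where one is north-west of the other; since
the launches are equal, noncrossing excludes either order. *)
Lemma strip_spans_inj P S S' p : HS P -> S \in P -> S' \in P -> spans S p -> spans S' p -> S = S'.
Proof.
move=> hP SP S'P sp sp'; apply/eqP; apply: contraT => /eqP neq; exfalso.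
have hpn : p < p + n <= p + n by lia.
have [b bS be] := spans_ex hr sp hpn; have [c cS' ce] := spans_ex hr sp' hpn.
have ebc : cont b = cont c by rewrite be.
case: (leqP (minn b.1 b.2) (minn c.1 c.2)) => h.
  have /andP[h1 h2] := cont_le hr ebc h.
  exact: (strip_noncrossing hP SP S'P neq sp sp' (leqnn _) bS cS' h1 h2).
have /andP[h1 h2] := cont_le hr (esym ebc) (ltnW h).
exact: (strip_noncrossing hP S'P SP (not_eq_sym neq) sp' sp (leqnn _) cS' bS h1 h2).
Qed.

Lemma strip_remove P S : HS P -> S \in P -> E \subset D -> is_young (D :\: S) ->
  [/\ horizontal_strip n ((D :\: S) :\: E) (P :\ S), S \subset D & E \subset D :\: S].
Proof.
move=> hP SP sED yDS; have sSF := strip_sub hP SP.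
have sSD : S \subset D by apply: (subset_trans sSF); exact: subsetDl.
have sE : E \subset D :\: S.
  apply/subsetP => b bE; rewrite inE (subsetP sED) // andbT; apply/negP => /(subsetP sSF).
  by rewrite inE bE.
split=> //; have eF : (D :\: S) :\: E = (D :\: E) :\: S by rewrite !setDDl setUC.
apply/andP; split.
  apply/and3P; split; first exact: skewD.
    by rewrite eF; apply: partitionD1 => //; apply: strip_partition hP.
  by apply/forall_inP => T; rewrite !inE => /andP[_ TP]; apply: strip_ribbon hP TP.
apply/forall_inP => T; rewrite !inE => /andP[_ TP]; apply/forallP => b; apply/implyP => tr.
have /forall_inP /(_ T TP) /forallP /(_ b) := proj2 (andP hP); rewrite tr /=.
apply: contra => /exists_inP[c]; rewrite eF inE => /andP[_ cF] h.
by apply/exists_inP; exists c.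
Qed.

(** The head of the new ribbon touches the north because all contents of [P] are
at most that of the head; the other heads are not affected because the new ribbon
is not north-west of any box of the smaller diagram. *)
Lemma strip_add P S p : is_young (D :\: S) -> S \subset D -> E \subset D :\: S ->
  spans S p -> (forall T p', T \in P -> spans T p' -> p' < p) ->
  horizontal_strip n ((D :\: S) :\: E) P -> HS (S |: P).
Proof.
move=> yDS sSD sE sp mx hP; have clDS := youngP _ yDS.
have sED : E \subset D by apply: (subset_trans sE); exact: subsetDl.
have hpn : p < p + n <= p + n by lia.
have [b0 b0S b0e] := spans_ex hr sp hpn.
have skS : is_skew S.
  by have := skewD yD yDS (subsetDl _ _); rewrite setDDr setDv set0U (setIidPr sSD).
have rS : is_ribbon n S.
  by apply: (spans_ribbon hr skS sp); rewrite -b0e; apply: cont_lt hr _.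
have eF : D :\: E = S :|: ((D :\: S) :\: E).
  apply/setP => b; rewrite !inE; case bS: (b \in S) => //=.
  rewrite (subsetP sSD) // andbT; apply/negP => /(subsetP sE); by rewrite inE bS.
apply/andP; split.
  apply/and3P; split; first exact: skewD.
    rewrite eF; apply: partitionU1; first exact: strip_partition hP.
      by apply/set0Pn; exists b0.
    by rewrite disjoints_subset; apply/subsetP => b bS; rewrite !inE bS andbF.
  by apply/forall_inP => T; rewrite !inE => /orP[/eqP->//|TP]; apply: strip_ribbon hP TP.
apply/forall_inP => T; rewrite !inE => /orP[/eqP->|TP]; apply/forallP => b; apply/implyP => tr.
  move: tr; rewrite (top_right_cont b skS sp) => /andP[bS /eqP be].
  apply/negP => /exists_inP[c cF /andP[/eqP c1 /eqP c2]].
  have ce : cont c = (p + n).+1 by rewrite (cont_above hr c1 c2) be.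
  move: cF; rewrite eF inE => /orP[cS|cF].
    by have := spans_cont sp cS; rewrite ce; clear; lia.
  have [T' T'P cT] := strip_in hP cF.
  have [p' sp'] := ribbon_spans hr hn (strip_ribbon hP T'P).
  by have := mx T' p' T'P sp'; have := spans_cont sp' cT; rewrite ce; clear; lia.
have /forall_inP /(_ T TP) /forallP /(_ b) := proj2 (andP hP); rewrite tr /=.
apply: contra => /exists_inP[c]; rewrite eF inE => /orP[cS|cF] h; last first.
  by apply/exists_inP; exists c.
have bT : b \in T by case/andP: tr.
have := subsetP (strip_sub hP TP) b bT; rewrite inE => /andP[_ bDS].
case/andP: h => /eqP h1 /eqP h2.
have := clDS b c bDS; rewrite h2 -h1 leqnSn leqnn inE cS => /(_ isT isT).
by [].
Qed.

End TwoShapes.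
End Strips.

Section Launches.
Variables m k r n : nat.
Hypotheses (hr : m <= r) (hn : 0 < n).
Implicit Types (b : box m k) (D E S : {set box m k}) (P : {set {set box m k}}).

Notation cont := (cont r).
Notation bead := (bead r).
Notation spans := (spans r n).

Lemma spans_lt S p : spans S p -> p + n < k + r.
Proof.
move=> sp; have hpn : p < p + n <= p + n by clear -hn; lia.
by have [b bS <-] := spans_ex hr sp hpn; apply: cont_lt hr _.
Qed.

Lemma reflect_spin_beads D S p : is_young D -> is_young (D :\: S) -> S \subset D -> spans S p ->
  ribbon_spin (reflect_shape S) = \sum_(d < n.-1) ~~ bead D (p + d.+1).
Proof.
move=> yD yDS sub sp; have hp := spans_lt sp.
have sp' := spans_reflect hr (leqnn k) hn hp sp.
rewrite (@ribbon_spin_beads k m k (leqnn k) n (reflect_shape D) _ _ hn _ _ _ sp') ?young_reflect //; first last.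
- exact: reflect_sub.
- by rewrite -reflect_shapeD young_reflect.
rewrite (reindex_inj rev_ord_inj); apply: eq_bigr => d _ /=.
have hd := ltn_ord d.
rewrite (bead_reflect hr (leqnn k)) //; last by clear -hp hd; lia.
by congr (nat_of_bool (~~ bead D _)); clear -hp hd; lia.
Qed.

Lemma strip_max P F : horizontal_strip n F P -> P != set0 ->
  exists S p, [/\ S \in P, spans S p & forall S' p', S' \in P -> spans S' p' -> p' <= p].
Proof.
move=> hP /set0Pn[S0 S0P].
have spmax S p : spans S p -> \max_(b in S) cont b = p + n.
  move=> sp; apply/eqP; rewrite eqn_leq; apply/andP; split.
    by apply/bigmax_leqP => b bS; have /andP[] := spans_cont sp bS.
  have hpn : p < p + n <= p + n by clear -hn; lia.
  by have [b bS <-] := spans_ex hr sp hpn; apply: (leq_bigmax_cond (F := cont)).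
have [S SP Smax] := arg_maxnP (fun S : {set box m k} => \max_(b in S) cont b) S0P.
have [p sp] := ribbon_spans hr hn (strip_ribbon hP SP).
exists S, p; split => // S' p' S'P sp'.
by have := Smax S' S'P; rewrite /= (spmax _ _ sp) (spmax _ _ sp') leq_add2r.
Qed.

(** Peeling off the ribbon with the rightmost launch. The beads that this ribbon
jumps over are exactly those that stay in place or arrive there. *)
Lemma strip_launches E D P : is_young E -> is_young D -> E \subset D ->
  horizontal_strip n (D :\: E) P ->
  exists L : pred nat,
    [/\ conserves n (bead E) (bead D) L, collision_free n (bead E) L,
        forall p, L p <-> exists2 S, S \in P & spans S p
      & forall (R : comNzRingType) (q t x : R) M, k + r <= M ->
        (\prod_(S in P) (q ^+ ribbon_spin S * t ^+ ribbon_spin (reflect_shape S) * x)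
         = launch_weight n M L (fun j => if bead E j || arrives n L j then q else t) x)%R].
Proof.
move=> yE; have [N] := ubnP #|P|; elim: N P D => // N IHN P D hN yD sED hP.
case: (eqVneq P set0) => [P0|Pn0].
  exists pred0; rewrite P0.
  have DE : D = E.
    apply/eqP; rewrite eqEsubset sED andbT; apply/subsetP => b bD; apply: contraT => bE.
    have bF : b \in D :\: E by rewrite inE bE.
    by have [S] := strip_in hP bF; rewrite P0 inE.
  split.
  - by move=> j; rewrite DE /arrives /= andbF.
  - by move=> j; rewrite /arrives andbF andbF.
  - by move=> p; split=> // -[S]; rewrite inE.
  by move=> R q t x M _; rewrite big_set0 /launch_weight big_pred0.
have [S [p [SP sp mx]]] := strip_max hP Pn0.
have yDS := strip_last_removable hr hn yE yD hP SP sp mx.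
have [hP' sSD sE] := strip_remove yE hP SP sED yDS.
have hN' : #|P :\ S| < N by rewrite (cardsD1 S) SP in hN.
have [L1 [h1 h2 h3 h4]] := IHN _ _ hN' yDS sE hP'.
have L1p c : L1 c -> c < p.
  move/h3 => [T]; rewrite !inE => /andP[/eqP TS TP] spT.
  rewrite ltn_neqAle (mx T c TP spT) andbT; apply/eqP => cp; apply: TS.
  by rewrite cp in spT; apply: (strip_spans_inj hr hn yE yD hP TP SP spT sp).
have nL1 c : p <= c -> L1 c = false.
  by move=> hc; apply/negP => /L1p; rewrite ltnNge hc.
pose L : pred nat := fun c => (c == p) || L1 c.
have LE j : L j = L1 j + (j == p) :> nat.
  by rewrite /L; case: (eqVneq j p) => [->|_] /=; [rewrite nL1 | rewrite addn0].
have arrE j : arrives n L j = arrives n L1 j + (j == p + n) :> nat.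
  rewrite /arrives /L; case: leqP => hj /=; last by clear -hj hn; case: eqP => [e|]; lia.
  have -> : (j - n == p) = (j == p + n) by clear -hj; lia.
  by case: (eqVneq j (p + n)) => [->|_] /=; [rewrite addnK nL1 | rewrite addn0].
have mv j := bead_move hr j hn yD yDS sSD sp.
have hM' := spans_lt sp.
exists L; split.
- move=> j; have := h1 j; have := mv j; rewrite LE arrE.
  by case: (bead D j) (bead (D :\: S) j) (bead E j) => -[] []; clear; lia.
- move=> j; have := h2 j; have := arrE j; case: (eqVneq j (p + n)) => [->|_].
    have := mv (p + n); have := h1 (p + n).
    have -> : L1 (p + n) = false by apply: nL1; rewrite leq_addr.
    have -> : arrives n L1 (p + n) = false by rewrite /arrives addnK nL1 ?andbF.
    by rewrite eqxx; case: (bead D _) (bead (D :\: S) _) (bead E _) => -[] [] /=; clear -hn; lia.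
  by rewrite addn0; case: (arrives n L _) (arrives n L1 _) => -[].
- move=> c; split => [/orP[/eqP->|/h3[T]]|[T TP spT]].
  + by exists S.
  + by rewrite !inE => /andP[_ TP] spT; exists T.
  rewrite /L; case: (eqVneq T S) => [TS|TS].
    by rewrite TS in spT; rewrite (spans_uniq hr hn spT sp) eqxx.
  by apply/orP; right; apply/h3; exists T => //; rewrite !inE TS.
have arrlt j : j < p + n -> arrives n L j = arrives n L1 j.
  move=> hj; have := arrE j; rewrite [j == _](_ : _ = false) ?addn0.
    by case: (arrives n L _) (arrives n L1 _) => -[].
  by apply/eqP => e; rewrite e ltnn in hj.
move=> R q t x M hM; have pM : p < M by clear -hM hM'; lia.
rewrite (big_setD1 S) //= (h4 R q t x M hM) /launch_weight [RHS](bigD1 (Ordinal pM)) /= ?/L ?eqxx //.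
congr (_ * _)%R.
  rewrite (ribbon_spin_beads hr hn yD yDS sSD sp) (reflect_spin_beads yD yDS sSD sp).
  rewrite -(prod_if q t n.-1 (fun d => bead D (p + d.+1))) mulrC; congr (x * _)%R;
    apply: eq_bigr => d _.
  have hd := ltn_ord d; have hlt : p + d.+1 < p + n by clear -hd; lia.
  rewrite arrlt //; have := h1 (p + d.+1); have := mv (p + d.+1).
  rewrite nL1 ?leq_addr //.
  have -> : (p + d.+1 == p) = false by clear; lia.
  have -> : (p + d.+1 == p + n) = false by clear -hd; lia.
  by case: (bead D _) (bead (D :\: S) _) (bead E _) (arrives n L1 _) => -[] [] [].
apply: eq_big => [c|c /L1p hc].
  by rewrite /L -val_eqE /=; case: (eqVneq (c : nat) p) => [->|_] /=;
    [rewrite nL1 | rewrite andbT].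
congr (x * _)%R; apply: eq_bigr => d _; have hd := ltn_ord d.
by rewrite arrlt //; clear -hc hd; lia.
Qed.

(** Conversely, admissible launches onto a Young diagram [D] can be undone from
the right, which peels ribbons off [D]. *)
Lemma launches_strip N (L V : pred nat) D : (forall c, L c -> c < N) -> is_young D ->
  conserves n V (bead D) L -> collision_free n V L ->
  exists E P, [/\ is_young E, E \subset D, bead E =1 V, horizontal_strip n (D :\: E) P
    & forall S, S \in P -> exists2 p, L p & spans S p].
Proof.
elim: N L D => [|N IHN] L D hL yD cons cf.
  have L0 c : L c = false by apply/negP => /hL.
  exists D, set0; split => //.
  - by move=> j; have := cons j; rewrite /arrives !L0 andbF !addn0; case: (bead _ _) (V j) => -[].
  - rewrite setDv; apply/andP; split; last by apply/forall_inP => S; rewrite inE.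
    apply/and3P; split; last by apply/forall_inP => S; rewrite inE.
      by have := skewD yD yD (subxx D); rewrite setDv.
    by apply/and3P; split; rewrite ?inE // /cover ?big_set0 // /trivIset /cover !big_set0 cards0.
  by move=> S; rewrite inE.
case LN: (L N); last first.
  apply: IHN => // c Lc; rewrite ltn_neqAle -ltnS hL // andbT.
  by apply/eqP => e; rewrite -e Lc in LN.
have nL c : N < c -> L c = false.
  by move=> hc; apply/negP => /hL; rewrite ltnS leqNgt hc.
have arN : arrives n L (N + n) by rewrite /arrives addnK leq_addl LN.
have VN : V (N + n) = false.
  by have := cf (N + n); rewrite arN andbT => /negbTE.
have b1 : bead D (N + n).
  have := cons (N + n); rewrite arN VN nL; last by clear -hn; lia.
  by case: (bead D _).
have b0 : ~~ bead D N.
  by have := cons N; have := cf N; rewrite LN; case: (bead D N) (V N) (arrives n L N) => -[] [].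
pose S := rim r n D N.
have sp : spans S N := rim_spans hr yD b1 b0.
have yDS : is_young (D :\: S) := rim_removable hr yD b1 b0.
have sSD : S \subset D := rim_sub r n D N.
pose L1 : pred nat := fun c => (c != N) && L c.
have L1E j : L j = L1 j + (j == N) :> nat.
  by rewrite /L1; case: eqP => [->|]; rewrite ?LN ?addn0.
have arrE j : arrives n L j = arrives n L1 j + (j == N + n) :> nat.
  rewrite /arrives /L1; case: leqP => hj /=; last by clear -hj hn; case: eqP => [e|]; lia.
  have -> : (j - n == N) = (j == N + n) by clear -hj; lia.
  by case: eqP => [->|] /=; rewrite ?addnK ?LN ?addn0.
have [||||E [P [yE sE bE hP spP]]] := IHN L1 (D :\: S).
- by move=> c /andP[cN /hL]; rewrite ltnS leq_eqVlt (negbTE cN).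
- by [].
- move=> j; have := cons j; have := bead_move hr j hn yD yDS sSD sp.
  by have := L1E j; have := arrE j; clear; lia.
- move=> j; have := cf j; have := arrE j.
  by case: (V j) => //=; case: (arrives n L j) (arrives n L1 j) => -[].
have mx T p' : T \in P -> spans T p' -> p' < N.
  move=> TP spT; have [p /andP[pN /hL hp] spT'] := spP T TP.
  by rewrite (spans_uniq hr hn spT spT') ltn_neqAle pN.
exists E, (S |: P); split => //; first exact: subset_trans sE (subsetDl _ _).
  exact: (strip_add hr hn yE yD yDS sSD sE sp mx hP).
move=> T; rewrite !inE => /orP[/eqP->|/spP[p /andP[_ Lp] spT]]; first by exists N.
by exists p.
Qed.

(** The launches are determined by the two diagrams, and the ribbon launched last
is a segment of the rim. *)
Lemma strip_uniq E D P P' : is_young E -> is_young D -> E \subset D ->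
  horizontal_strip n (D :\: E) P -> horizontal_strip n (D :\: E) P' -> P = P'.
Proof.
move=> yE; have [N] := ubnP #|P|; elim: N P P' D => // N IHN P P' D hN yD sED hP hP'.
have [L [c1 _ hL _]] := strip_launches yE yD sED hP.
have [L' [c2 _ hL' _]] := strip_launches yE yD sED hP'.
have LL' := launches_uniq hn c1 c2.
case: (eqVneq P set0) => [P0|Pn0].
  apply/esym/eqP; rewrite P0; apply: contraT => /set0Pn[S SP'].
  have [p sp] := ribbon_spans hr hn (strip_ribbon hP' SP').
  have : L p by rewrite LL'; apply/hL'; exists S.
  by move/hL => [T]; rewrite P0 inE.
have [S [p [SP sp mx]]] := strip_max hP Pn0.
have [S' S'P' sp'] : exists2 S, S \in P' & spans S p.
  by apply/hL'; rewrite -LL'; apply/hL; exists S.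
have mx' T p' : T \in P' -> spans T p' -> p' <= p.
  move=> TP' spT; have : L p' by rewrite LL'; apply/hL'; exists T.
  by move/hL => [T' T'P spT']; exact: mx T'P spT'.
have yDS := strip_last_removable hr hn yE yD hP SP sp mx.
have yDS' := strip_last_removable hr hn yE yD hP' S'P' sp' mx'.
have [hP1 sSD sE] := strip_remove yE hP SP sED yDS.
have [hP1' sSD' _] := strip_remove yE hP' S'P' sED yDS'.
have SS' : S = S'.
  by rewrite (removable_rim hr yD yDS sSD sp) (removable_rim hr yD yDS' sSD' sp').
rewrite -(setD1K SP) -(setD1K S'P') -SS'; congr (S |: _).
rewrite -SS' in hP1'; apply: (IHN _ _ _ _ yDS sE hP1 hP1').
by rewrite (cardsD1 S) SP in hN.
Qed.

End Launches.

(** * One row of the lattice model *)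

Section RowStates.
Variables n M : nat.
Hypothesis hn : 0 < n.
Implicit Types (V : {ffun 'I_M -> varrow}) (L : pred nat).

Definition ups V : pred nat := fun q => [exists c : 'I_M, (c == q :> nat) && (V c == Up)].

Lemma upsE V (c : 'I_M) : ups V c = (V c == Up).
Proof.
apply/existsP/idP => [[d /andP[/eqP/ord_inj-> //]]|h]; by exists c; rewrite eqxx.
Qed.

Lemma ups_big V q : M <= q -> ups V q = false.
Proof. by move=> hq; apply/existsP => -[c /andP[/eqP e _]]; have := ltn_ord c; clear -hq e;
  lia. Qed.

(** If one regards up and left arrows as particles, the arrow count says that the
particles entering from the north and the west leave to the south and the east;
those within the tuples cancel because of the shift. *)
Lemma admissibleE N S (W E : n.-tuple harrow) :
  admissible N S W E =
  ((S == Up) + (nth Right E n.-1 == Left) == (N == Up) + (nth Right W 0 == Left)) &&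
  [forall i : 'I_n.-1, nth Right E i == nth Right W i.+1].
Proof.
rewrite /admissible; case: (boolP [forall i, _]) => [/forallP sh|]; rewrite ?andbF ?andbT //.
case: n hn W E sh => // n' _ W E sh; rewrite /arrows_in /arrows_out.
have sE : size E = n'.+1 by rewrite size_tuple.
have sW : size W = n'.+1 by rewrite size_tuple.
move: (tval E) (tval W) sE sW sh => e w.
case/lastP: e => // e a; case: w => // b w; rewrite size_rcons => -[se] [sw] sh.
have {w sw sh} <- : e = w.
  apply: (@eq_from_nth _ Right); first by rewrite se sw.
  move=> i; rewrite se => hi; have := sh (Ordinal hi).
  by rewrite nth_rcons se hi => /eqP.
rewrite /= nth_rcons se ltnn eqxx -cats1 !count_cat /=.
by case: N S a b => -[] [] [] /=; lia.
Qed.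

(** The particle in entry [i] of a tuple has [i] more columns to cross, hence was
launched [n - i] columns before. *)
Definition flights L : {ffun 'I_M.+1 -> n.-tuple harrow} :=
  [ffun j : 'I_M.+1 =>
     [tuple (if (n - i <= j) && L (j - (n - i)) then Left else Right) | i < n]].

Lemma nth_flights L (j : 'I_M.+1) i : i < n ->
  nth Right (flights L j) i = if (n - i <= j) && L (j - (n - i)) then Left else Right.
Proof.
move=> hi; rewrite ffunE -[i]/(val (Ordinal hi)) -tnth_nth tnth_mktuple //.
Qed.

Lemma flights_W L (j : 'I_M.+1) : (nth Right (flights L j) 0 == Left) = arrives n L j.
Proof. by rewrite nth_flights // subn0 /arrives; case: (_ && _). Qed.

Lemma flights_E L (c : 'I_M) : (nth Right (flights L (lift ord0 c)) n.-1 == Left) = L c.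
Proof.
rewrite nth_flights ?prednK // (_ : n - n.-1 = 1); last by clear -hn; lia.
by rewrite lift0 subn1 /=; case: (L c).
Qed.

(** The statistic [s] of the vertex weights: launches that are still in the air. *)
Definition flying L c := \sum_(d < n.-1) ((d < c) && L (c - d.+1)).

Lemma left_arrows_flights L (c : 'I_M) : left_arrows (flights L (lift ord0 c)) = flying L c.
Proof.
have countE (s : seq harrow) : count_mem Left s = \sum_(i < size s) (nth Right s i == Left).
  by rewrite -sum1_count (big_nth Right) big_mkord big_mkcond; apply: eq_bigr => i _ /=;
    case: (nth _ _ _).
rewrite /left_arrows countE size_take size_tuple prednK // leqnn.
rewrite (reindex_inj rev_ord_inj) /=; apply: eq_bigr => d _; have hd := ltn_ord d.
rewrite nth_take; last by clear -hd; lia.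
rewrite nth_flights; last by clear -hd; lia.
rewrite lift0 (_ : n - (n.-1 - d.+1) = d.+2); last by clear -hd; lia.
by rewrite ltnS subSS; case: (_ && _).
Qed.

Definition row_boundary (H : {ffun 'I_M.+1 -> n.-tuple harrow}) :=
  (H ord0 == nseq_tuple n Right) && (H ord_max == nseq_tuple n Right).

Definition row_admissible V V' (H : {ffun 'I_M.+1 -> n.-tuple harrow}) :=
  [forall c : 'I_M, admissible (V c) (V' c) (H (widen_ord (leqnSn _) c)) (H (lift ord0 c))].

(** Horizontal arrows are carried along unchanged for [n] columns, so a row is
determined by the columns in which a particle leaves its vertical edge. *)
Lemma row_admissible_launches V V' H : row_boundary H -> row_admissible V V' H ->
  exists L, [/\ conserves n (ups V) (ups V') L, (forall c, L c -> c < M) & H = flights L].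
Proof.
move=> /andP[/eqP H0 /eqP HM] /forallP adm.
pose L : pred nat := fun c => (c < M) && (nth Right (H (inord c.+1)) n.-1 == Left).
have sh (c : 'I_M) i : i < n.-1 ->
    nth Right (H (lift ord0 c)) i = nth Right (H (widen_ord (leqnSn _) c)) i.+1.
  move=> hi; have := adm c; rewrite admissibleE => /andP[_ /forallP /(_ (Ordinal hi))].
  by move/eqP.
have HL j (hj : j < M.+1) i : i < n ->
   nth Right (H (Ordinal hj)) i = if (n - i <= j) && L (j - (n - i)) then Left else Right.
  elim: j hj i => [|j IHj] hj i hi.
    have -> : Ordinal hj = ord0 by apply: ord_inj.
    by rewrite H0 nth_nseq hi leqn0 subn_eq0 leqNgt hi.
  have hj' : j < M by [].
  have -> : Ordinal hj = lift ord0 (Ordinal hj') by apply: ord_inj.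
  case: (ltnP i n.-1) => hi'.
    rewrite sh // (_ : widen_ord _ _ = Ordinal (ltnW hj)); last by apply: ord_inj.
    rewrite IHj; last by clear -hi'; lia.
    have -> : n - i = (n - i.+1).+1 by clear -hi; lia.
    by rewrite ltnS subSS.
  have -> : i = n.-1 by clear -hi hi'; lia.
  rewrite (_ : n - n.-1 = 1); last by clear -hn; lia.
  rewrite subn1 /L hj' /=.
  have -> : inord j.+1 = lift ord0 (Ordinal hj') by apply: ord_inj; rewrite inordK.
  by case: (nth _ _ _).
have HE : H = flights L.
  apply/ffunP => -[j hj]; apply: val_inj; apply: (@eq_from_nth _ Right); rewrite ?size_tuple //.
  by move=> i hi; rewrite HL // nth_flights.
have Lsupp c : L c -> c < M by case/andP.
exists L; split => // q.
case: (ltnP q M) => hq; last first.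
  rewrite !ups_big // (_ : L q = false); last by apply/negP => /Lsupp; rewrite ltnNge hq.
  apply/esym/eqP; rewrite !add0n eqb0; apply/negP => /andP[hnq Lq].
  have hi : M - (q - n).+1 < M.+1 by clear; lia.
  have := HL M (ltnSn M) (n - (M - (q - n))).
  have -> : Ordinal (ltnSn M) = ord_max by apply: ord_inj.
  have lt := Lsupp _ Lq; rewrite HM nth_nseq.
  have h1 : n - (M - (q - n)) < n by clear -lt hn; lia.
  move=> /(_ h1); rewrite h1.
  have -> : n - (n - (M - (q - n))) = M - (q - n) by clear -lt hq hnq; lia.
  by rewrite leq_subr subKn ?Lq // ltnW.
have := adm (Ordinal hq); rewrite admissibleE => /andP[/eqP + _].
by rewrite {1}HE flights_E {1}HE flights_W -!upsE.
Qed.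

Lemma launches_supp V V' L c : conserves n (ups V) (ups V') L -> (forall c, L c -> c < M) ->
  L c -> c + n < M.
Proof.
move=> cons supp Lc; rewrite ltnNge; apply/negP => hc.
have := cons (c + n); rewrite !ups_big // /arrives leq_addl addnK Lc.
by case Lcn: (L (c + n)) => //; have := supp _ Lcn; rewrite ltnNge hc.
Qed.

Lemma flights_boundary V V' L : conserves n (ups V) (ups V') L -> (forall c, L c -> c < M) ->
  row_boundary (flights L) /\ row_admissible V V' (flights L).
Proof.
move=> cons supp; split.
  apply/andP; split; apply/eqP/val_inj; apply: (@eq_from_nth _ Right); rewrite ?size_tuple //;
    move=> i hi; rewrite nth_flights // nth_nseq hi /=.
    by rewrite leqn0 subn_eq0 leqNgt hi.
  case: ifP => // /andP[h /(launches_supp cons supp)].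
  by clear -h hi; lia.
apply/forallP => c; rewrite admissibleE flights_E flights_W -!upsE.
apply/andP; split; first by apply/eqP; exact: cons.
apply/forallP => i; have hi := ltn_ord i; rewrite !nth_flights; [|clear -hi; lia|clear -hi; lia].
rewrite lift0 /= (_ : n - i = (n - i.+1).+1); last by clear -hi; lia.
by rewrite ltnS subSS.
Qed.

Section RowSum.
Variables (R : comNzRingType) (p s : nat) (q : R) (x : 'I_p -> R) (y : 'I_s -> R).
Local Open Scope ring_scope.

Definition row_weight (l : letter p s) V V' (H : {ffun 'I_M.+1 -> n.-tuple harrow}) : R :=
  \prod_(c < M) vertex_weight q x y l (V c) (V' c)
    (H (widen_ord (leqnSn _) c)) (H (lift ord0 c)).

Definition row_sum l V V' : R := \sum_(H | row_boundary H) row_weight l V V' H.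

(** The six vertex types in terms of particles. The excluded case is SE (landing on
an occupied place) in a horizontal row, NE (relaunching on arrival) in a vertical
one. *)
Definition launch_factor (l : letter p s) (V L : pred nat) (c : nat) : R :=
  match l with
  | inl a => if V c && arrives n L c then 0 else
      (if V c || arrives n L c then q else 1) ^+ flying L c * (if L c then x a else 1)
  | inr b => if ~~ V c && L c then 0 else
      (if V c && ~~ L c then q else 1) ^+ flying L c * (if L c then - y b else 1)
  end.

(** The launches, hence the horizontal arrows, are unique, so that the sum has a
single term that may be nonzero. *)
Lemma row_sum_launches l V V' L :
  conserves n (ups V) (ups V') L -> (forall c, L c -> (c < M)%N) ->
  row_sum l V V' = \prod_(c < M) launch_factor l (ups V) L c.
Proof.
move=> cons supp; have [bF aF] := flights_boundary cons supp.
rewrite /row_sum (bigD1 (flights L)) //= big1 ?addr0; last first.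
  move=> H /andP[bH /eqP neq]; case: (boolP (row_admissible V V' H)) => [adm|].
    have [L' [c1 c2 HL]] := row_admissible_launches bH adm; case: neq; rewrite HL.
    have LL := launches_uniq hn cons c1.
    by apply/ffunP => j; apply: eq_from_tnth => i; rewrite !ffunE !tnth_mktuple LL.
  rewrite negb_forall => /existsP[c nadm].
  by rewrite /row_weight (bigD1 c) //= /vertex_weight (negbTE nadm) mul0r.
apply: eq_bigr => c _; rewrite /vertex_weight (forallP aF c) left_arrows_flights /type_of.
have := cons c; have := flights_E L c.
have := flights_W L (widen_ord (leqnSn M) c); rewrite /launch_factor !upsE /=.
case: (nth Right _ 0) => /= <-; case: (nth Right _ n.-1) => /= <-;
  case: (V c) (V' c) => -[] //= _; case: l => l /=; rewrite ?expr1n ?mulr1 ?mul1r //.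
Qed.

Lemma row_sum_cases l V V' : row_sum l V V' = 0 \/
  exists L, [/\ conserves n (ups V) (ups V') L, forall c, L c -> (c < M)%N
    & match l with
      | inl _ => collision_free n (ups V) L
      | inr _ => forall c, L c -> ups V c
      end].
Proof.
case: (boolP [exists H, row_boundary H && row_admissible V V' H]) => [/existsP[H /andP[bH aH]]|noH].
  have [L [cons supp _]] := row_admissible_launches bH aH.
  have sumE := row_sum_launches l cons supp.
  case: (boolP [exists c : 'I_M, match l with inl _ => ups V c && arrives n L c
                                        | inr _ => ~~ ups V c && L c end]) => [/existsP[c hc]|].
    by left; rewrite sumE (bigD1 c) //=; case: l hc {sumE} => l /= ->; rewrite mul0r.
  rewrite negb_exists => /forallP ok; right; exists L; split=> //.
  case: l ok {sumE} => l ok.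
    move=> c; case: (ltnP c M) => hc; last by rewrite ups_big.
    exact: ok (Ordinal hc).
  by move=> c Lc; have := ok (Ordinal (supp c Lc)); rewrite /= Lc andbT negbK.
left; apply: big1 => H bH; have : ~~ row_admissible V V' H.
  by move: noH; rewrite negb_exists => /forallP/(_ H); rewrite bH.
rewrite negb_forall => /existsP[c nadm].
by rewrite /row_weight (bigD1 c) //= /vertex_weight (negbTE nadm) mul0r.
Qed.

Lemma prod_window (L : pred nat) (a : nat -> R) d : (d < n.-1)%N ->
  (forall c, L c -> (c + n < M)%N) ->
  \prod_(c < M) (if (d < c)%N && L (c - d.+1)%N then a c else 1) =
  \prod_(c < M) (if L c then a (c + d.+1)%N else 1).
Proof.
move=> hd supp.
rewrite -(big_mkord predT (fun c => if (d < c)%N && L (c - d.+1)%N then a c else 1)).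
rewrite -(big_mkord predT (fun c => if L c then a (c + d.+1)%N else 1)).
have low N : (N <= d.+1)%N ->
    \prod_(0 <= c < N) (if (d < c)%N && L (c - d.+1)%N then a c else 1) = 1.
  move=> hN; rewrite big_nat_cond big1 // => c /andP[/andP[_ hc] _].
  by rewrite ltnNge -ltnS (leq_trans hc hN).
have high N : (M <= N + d.+1)%N ->
    \prod_(N <= c < M) (if L c then a (c + d.+1)%N else 1) = 1.
  move=> hN; rewrite big_nat_cond big1 // => c /andP[/andP[hc _] _].
  by case Lc: (L c) => //; have := supp c Lc; clear -hN hd hc; lia.
case: (leqP d.+1 M) => hM; last by rewrite low ?(ltnW hM) // high // (ltnW hM).
rewrite (@big_cat_nat _ _ _ d.+1) //= low // mul1r -{1}[d.+1]add0n big_addn.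
rewrite [RHS](@big_cat_nat _ _ _ (M - d.+1)) ?leq_subr //= high ?subnK // mulr1.
by apply: eq_bigr => c _; rewrite addnK (_ : (d < c + d.+1)%N) //; clear; lia.
Qed.

(** Exchanges the product over the places below a flight with that over the
launches. *)
Lemma prod_flying (L : pred nat) (a : nat -> R) z : (forall c, L c -> (c + n < M)%N) ->
  \prod_(c < M) (a c ^+ flying L c * (if L c then z else 1)) = launch_weight n M L a z.
Proof.
move=> supp; rewrite big_split /= mulrC /launch_weight big_split /=.
congr (_ * _); first by rewrite [RHS]big_mkcond.
rewrite (eq_bigr (fun c : 'I_M => \prod_(d < n.-1)
   (if (d < c)%N && L (c - d.+1)%N then a c else 1))); last first.
  move=> c _; rewrite /flying; elim: n.-1 => [|N IHN]; first by rewrite !big_ord0 expr0.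
  by rewrite !big_ord_recr /= exprD IHN; case: (_ && _); rewrite ?expr1 ?expr0.
rewrite exchange_big /= [RHS]exchange_big /=; apply: eq_bigr => d _.
by rewrite prod_window // [RHS]big_mkcond.
Qed.

End RowSum.

(** ** Exchanging particles and gaps, and left and right

A particle flying from [c] to [c + n] moves a gap from [c + n] to [c], so that the
launches are mirrored with a shift by [n]. *)

Definition flip (V : pred nat) : pred nat := fun q => (q < M) && ~~ V (M - q.+1).
Definition flip_launch (L : pred nat) : pred nat :=
  fun q => (q + n < M) && L (M - (q + n).+1).

Lemma conserves_flip (V V' L : pred nat) :
  (forall c, L c -> c + n < M) -> conserves n V V' L ->
  conserves n (flip V) (flip V') (flip_launch L).
Proof.
move=> supp cons j; rewrite /flip /flip_launch /arrives.
case: (ltnP j M) => hj; last first.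
  have -> : (j + n < M) = false by clear -hj; lia.
  by case: (leqP n j) => hnj //=; rewrite subnK // ltnNge hj.
have := cons (M - j.+1); rewrite /arrives.
have -> : (n <= M - j.+1) = (j + n < M) by clear -hj; lia.
have -> : M - j.+1 - n = M - (j + n).+1 by clear; lia.
case: (leqP n j) => hnj /=.
  rewrite subnK // hj /=.
  by case: (V _) (V' _) (L (M - j.+1)) (_ && _) => -[] [] [].
have -> : L (M - j.+1) = false by apply/negP => /supp; clear -hnj hj; lia.
by case: (V _) (V' _) (_ && _) => -[] [].
Qed.

(** The exclusion rules of the two kinds of rows are exchanged. *)
Lemma flip_collision_free (V L : pred nat) :
  (forall q, L q -> V q) -> collision_free n (flip V) (flip_launch L).
Proof.
move=> LV q; apply/negP => /andP[/andP[_ nV] /andP[hq /andP[_ Lq]]].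
by rewrite subnK // in Lq; rewrite LV in nV.
Qed.

Lemma collision_free_flip (V L : pred nat) q :
  collision_free n V L -> flip_launch L q -> flip V q.
Proof.
move=> cf /andP[hq Lq]; rewrite /flip (_ : q < M); last by clear -hq; lia.
have := cf (M - q.+1); rewrite /arrives (_ : n <= M - q.+1); last by clear -hq; lia.
by rewrite (_ : M - q.+1 - n = M - (q + n).+1) ?Lq ?andbT //; clear; lia.
Qed.

Lemma flip_launchK (L : pred nat) : (forall c, L c -> c + n < M) ->
  flip_launch (flip_launch L) =1 L.
Proof.
move=> supp q; rewrite /flip_launch; apply/idP/idP => [/and3P[h1 h2]|Lq].
  by rewrite (_ : M - _ = q) //; clear -h1; lia.
have h := supp q Lq; rewrite h /= (_ : M - (M - (q + n).+1 + n).+1 = q); last by clear -h; lia.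
by rewrite Lq andbT; clear -h; lia.
Qed.

Lemma launch_weight_flip (R : comNzRingType) (L : pred nat) (a : nat -> R) z :
  launch_weight n M (flip_launch L) a z =
  launch_weight n M (fun c => (c + n < M) && L c) (fun j => a (M - j.+1)) z.
Proof.
rewrite /launch_weight.
have nar (P : pred nat) (F : nat -> R) :
    (\prod_(c < M | (c + n < M)%N && P c) F c = \prod_(c < M - n | P c) F c)%R.
  rewrite (big_ord_widen_cond M P F) ?leq_subr //; apply: eq_bigl => c.
  by rewrite andbC; congr (_ && _); clear; lia.
etransitivity.
  exact: (nar (fun c => L (M - (c + n).+1)) (fun c => z * \prod_(d < n.-1) a (c + d.+1)%N)%R).
apply/esym; etransitivity.
  exact: (nar L (fun c => z * \prod_(d < n.-1) a (M - (c + d.+1).+1)%N)%R).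
apply/esym.
rewrite (reindex_inj rev_ord_inj) /=; apply: eq_big => [c|c _].
  by congr L; have := ltn_ord c; clear; lia.
congr (_ * _)%R; rewrite (reindex_inj rev_ord_inj) /=; apply: eq_bigr => d _; congr a.
by have := ltn_ord c; have := ltn_ord d; clear; lia.
Qed.

End RowStates.

(** * Rows of the lattice and strips of ribbons *)

Section RowStrip.
Variables m k r n : nat.
Hypotheses (hr : m <= r) (hn : 0 < n).
Implicit Types (D E S : {set box m k}) (P : {set {set box m k}}).
Notation M := (k + r).

Definition arrows D : {ffun 'I_M -> varrow} :=
  [ffun c : 'I_M => if bead r D c then Up else Down].

Lemma ups_arrows D : ups (arrows D) =1 bead r D.
Proof.
move=> j; case: (ltnP j M) => hj; last by rewrite ups_big // bead_big.
by rewrite (upsE _ (Ordinal hj)) ffunE /=; case: (bead r D j).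
Qed.

Lemma arrows_ups V D : ups V =1 bead r D -> V = arrows D.
Proof.
move=> e; apply/ffunP => c; rewrite ffunE -e upsE; by case: (V c).
Qed.

Lemma arrows_inj D E : is_young D -> is_young E -> arrows D = arrows E -> D = E.
Proof.
move=> yD yE e; apply: (bead_inj hr yD yE) => j.
by rewrite -!ups_arrows e.
Qed.

Lemma flip_bead D : is_young D -> flip M (bead r D) =1 bead k (reflect_shape D).
Proof.
move=> yD j; rewrite /flip; case: ltnP => hj /=;
  first by rewrite (bead_reflect hr (leqnn k) yD hj).
by rewrite bead_big // (leq_trans _ hj) // addnC leq_add2l.
Qed.

Lemma flip_bead_reflect D : is_young D -> flip M (bead k (reflect_shape D)) =1 bead r D.
Proof.
move=> yD j; rewrite /flip; case: ltnP => hj /=; last by rewrite bead_big.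
rewrite (bead_reflect hr (leqnn k) yD); last by clear -hj; lia.
by rewrite negbK; congr (bead r D _); clear -hj; lia.
Qed.

Variables (R : comNzRingType) (p s : nat) (q : R) (x : 'I_p -> R) (y : 'I_s -> R).
Implicit Type l : letter p s.
Notation row_sum := (row_sum n q x y).

Definition strip l (F : {set box m k}) P : bool :=
  match l with inl _ => horizontal_strip n F P | inr _ => vertical_strip n F P end.

Definition letter_variable l : R := (match l with inl a => x a | inr b => - y b end)%R.

Definition strip_weight l P : R := (\prod_(S in P) (q ^+ ribbon_spin S * letter_variable l))%R.

Lemma strip_row_sum l E D P : is_young E -> is_young D -> E \subset D ->
  strip l (D :\: E) P -> row_sum l (arrows E) (arrows D) = strip_weight l P.
Proof.
move=> yE yD sED; case: l => l; rewrite /strip /strip_weight /=.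
  move=> hP; have [L [cons cf spL wt]] := strip_launches hr hn yE yD sED hP.
  have supp c : L c -> c + n < M by case/spL => S _ /(spans_lt hr hn).
  have cons' : conserves n (ups (arrows E)) (ups (arrows D)) L.
    by move=> j; rewrite !ups_arrows.
  rewrite (row_sum_launches hn q x y (inl l) cons'); last first.
    by move=> c /supp; apply: leq_ltn_trans; rewrite leq_addr.
  rewrite (eq_bigr (fun S => (q ^+ ribbon_spin S * 1 ^+ ribbon_spin (reflect_shape S) * x l)%R)); last first.
    by move=> S _; rewrite expr1n mulr1.
  rewrite (wt R q 1%R (x l) M) // -(prod_flying _ _ supp); apply: eq_bigr => c _.
  by rewrite /= !ups_arrows (negbTE (cf c)).
rewrite /vertical_strip reflect_shapeD => hP.
have hM : m + k <= M by rewrite addnC leq_add2l.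
have [||L' [cons cf spL wt]] :=
  strip_launches (leqnn k) hn _ _ (reflect_sub sED) hP; rewrite ?young_reflect //.
have supp' c : L' c -> c + n < M.
  by case/spL => S _ /(spans_lt (leqnn k) hn) h; apply: leq_trans h hM.
pose L := flip_launch n M L'.
have supp c : L c -> c + n < M by case/andP.
have LV c : L c -> bead r E c.
  by move=> Lc; rewrite -(flip_bead_reflect yE); apply: collision_free_flip cf Lc.
have cons' : conserves n (ups (arrows E)) (ups (arrows D)) L.
  move=> j; rewrite !ups_arrows -!flip_bead_reflect //.
  exact: (conserves_flip supp' cons).
rewrite (row_sum_launches hn q x y (inr l) cons'); last first.
  by move=> c /supp; apply: leq_ltn_trans; rewrite leq_addr.
have -> : (\prod_(S in P) (q ^+ ribbon_spin S * - y l) =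
    \prod_(S in reflect_tiling P)
      (1 ^+ ribbon_spin S * q ^+ ribbon_spin (reflect_shape S) * - y l))%R.
  rewrite big_imset /=; last by move=> S S' _ _ /(can_inj (@reflect_shapeK _ _)).
  by apply: eq_bigr => S _; rewrite expr1n mul1r reflect_shapeK.
rewrite (wt R _ _ _ M hM).
transitivity (launch_weight n M L (fun j => if bead r E j && ~~ L j then q else 1%R) (- y l)%R).
  rewrite -(prod_flying _ _ supp); apply: eq_bigr => c _.
  rewrite /= !ups_arrows; case: ifP => // /andP[nE /LV Ec]; by rewrite Ec in nE.
have LK := flip_launchK supp'.
rewrite -(eq_launch_weight n M _ _ LK) launch_weight_flip /launch_weight.
apply: eq_big => [c|c Lc]; first by rewrite -/L; case Lc: (L c); rewrite ?andbF // supp.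
congr (_ * _)%R; apply: eq_bigr => d _; have hd := ltn_ord d; have hc := supp _ Lc.
set j := (c + d.+1)%N; have hj : (j < M)%N by rewrite /j; clear -hc hd; lia.
rewrite (bead_reflect hr (leqnn k) yE); last by clear -hj; lia.
rewrite (_ : (M - (M - j.+1).+1)%N = j); last by clear -hj; lia.
have -> : arrives n L' (M - j.+1) = L j.
  rewrite /arrives /L /flip_launch.
  rewrite (_ : (n <= M - j.+1) = (j + n < M))%N; last by clear -hj; lia.
  by congr (_ && L' _); clear; lia.
by case: (bead r E j) (L j) => -[].
Qed.

(** Undoing the launches of the row, or of the flipped row, leads from [D] to a
smaller Young diagram. *)
Lemma row_sum_strip_cases l V D : is_young D -> row_sum l V (arrows D) = 0%R \/
  exists E P, [/\ is_young E, E \subset D, V = arrows E & strip l (D :\: E) P].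
Proof.
move=> yD; have [->|[L [cons supp cf]]] := row_sum_cases hn q x y l V (arrows D); [by left|right].
have supp' c : L c -> c + n < M := launches_supp cons supp (c := c).
case: l cf => l cf.
  have consD : conserves n (ups V) (bead r D) L by move=> j; rewrite -ups_arrows.
  have [E [P [yE sE bE hP _]]] := launches_strip hr hn supp yD consD cf.
  by exists E, P; split => //; apply: arrows_ups => j; rewrite bE.
have consD : conserves n (flip M (ups V)) (bead k (reflect_shape D)) (flip_launch n M L).
  have consV : conserves n (ups V) (bead r D) L by move=> j; rewrite -ups_arrows.
  by move=> j; rewrite -flip_bead //; apply: (conserves_flip supp' consV).
have suppf c : flip_launch n M L c -> c < M.
  by case/andP => h _; apply: leq_ltn_trans h; rewrite leq_addr.
have yR : is_young (reflect_shape D) by rewrite young_reflect.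
have [E [P [yE sE bE hP _]]] :=
  launches_strip (leqnn k) hn suppf yR consD (flip_collision_free n M cf).
exists (reflect_shape E), (reflect_tiling P).
have yRE : is_young (reflect_shape E) by rewrite young_reflect.
split => //.
- by rewrite -[D]reflect_shapeK; apply: reflect_sub.
- apply: arrows_ups => j; rewrite -flip_bead_reflect // reflect_shapeK /flip.
  case: ltnP => hj /=; last by rewrite ups_big.
  rewrite bE /flip (_ : (M - j.+1 < M)%N); last by clear -hj; lia.
  by rewrite negbK; congr (ups V _); clear -hj; lia.
by rewrite /strip /vertical_strip reflect_shapeD reflect_shapeK reflect_tilingK.
Qed.

Lemma strip_tiling_uniq l E D P P' : is_young E -> is_young D -> E \subset D ->
  strip l (D :\: E) P -> strip l (D :\: E) P' -> P = P'.
Proof.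
move=> yE yD sED; case: l => l; rewrite /strip.
  exact: (strip_uniq hr hn yE yD sED).
rewrite /vertical_strip reflect_shapeD => h h'.
apply: (can_inj (@reflect_tilingK _ _)).
by apply: (strip_uniq (leqnn k) hn _ _ (reflect_sub sED) h h'); rewrite young_reflect.
Qed.

(** There is at most one strip, and the row sum is nonzero only if there is one. *)
Lemma row_sum_strips l E D : is_young E -> is_young D ->
  row_sum l (arrows E) (arrows D) =
  if E \subset D then (\sum_(P | strip l (D :\: E) P) strip_weight l P)%R else 0%R.
Proof.
move=> yE yD; case: (boolP (E \subset D)) => sED.
  case: (boolP [exists P, strip l (D :\: E) P]) => [/existsP[P hP]|].
    rewrite (big_pred1 P); first exact: strip_row_sum.
    move=> P'; apply/idP/eqP => [hP'|->//].
    exact: (strip_tiling_uniq yE yD sED hP' hP).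
  rewrite negb_exists => /forallP noP; rewrite big_pred0 => [|P]; last exact: negbTE.
  have [//|[E' [P [yE' _ /(arrows_inj yE yE') <- hP]]]] := row_sum_strip_cases l (arrows E) yD.
  by have := noP P; rewrite hP.
have [//|[E' [P [yE' sE' /(arrows_inj yE yE') e _]]]] := row_sum_strip_cases l (arrows E) yD.
by rewrite e sE' in sED.
Qed.

End RowStrip.

(** * Chains of Young diagrams *)

Section Rows.
Variables (p s : nat) (prec : rel (letter p s)).
Hypotheses (prec_total : total prec) (prec_anti : antisymmetric prec).
Hypothesis prec_trans : transitive prec.
Notation N := #|{: letter p s}|.
Notation row_letter := (row_letter prec).

Lemma row_letter_inj : injective row_letter.
Proof.
move=> i j /eqP; rewrite /row_letter !(tnth_nth (row_letter i)) nth_uniq.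
- by move/eqP/ord_inj.
- by rewrite size_tuple.
- by rewrite size_tuple.
- by rewrite /= sort_uniq enum_uniq.
Qed.

Lemma row_letter_bij : bijective row_letter.
Proof. by apply: inj_card_bij row_letter_inj _; rewrite card_ord. Qed.

Lemma prec_row_letter i j : prec (row_letter i) (row_letter j) = (i <= j).
Proof.
have refl : reflexive prec by move=> l; have := prec_total l l; rewrite orbb.
have srt (a b : 'I_N) : a <= b -> prec (row_letter a) (row_letter b).
  move=> ab; rewrite /row_letter !(tnth_nth (row_letter a)).
  apply: (sorted_leq_nth prec_trans refl _ (sort_sorted prec_total _)) => //;
    by rewrite inE size_tuple.
apply/idP/idP => [pij|]; last exact: srt.
rewrite leqNgt; apply/negP => ji.
have e : row_letter i = row_letter j by apply: prec_anti; rewrite pij srt // ltnW.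
by rewrite (row_letter_inj e) ltnn in ji.
Qed.

End Rows.

Lemma partition_intro (T : finType) (P : {set {set T}}) (F : {set T}) :
  (forall b, (b \in F) = [exists S in P, b \in S]) ->
  (forall S S' b, S \in P -> S' \in P -> b \in S -> b \in S' -> S = S') ->
  set0 \notin P -> partition P F.
Proof.
move=> cov dis n0; apply/and3P; split => //.
  apply/eqP/setP => b; rewrite cov; apply/bigcupP/exists_inP => -[S SP bS]; by exists S.
apply/trivIsetP => S S' SP S'P neq; rewrite disjoints_subset; apply/subsetP => b bS.
by rewrite inE; apply: contraNN neq => bS'; apply/eqP; apply: dis bS bS'.
Qed.

Section StripBasics.
Variables m k n : nat.
Hypothesis hn : 0 < n.
Implicit Types (D E F S : {set box m k}) (P : {set {set box m k}}).

Lemma skew_reflect S : is_skew (reflect_shape S) -> is_skew S.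
Proof.
case/existsP => D /existsP[E /and4P[yD yE sED /eqP e]].
apply/existsP; exists (reflect_shape D); apply/existsP; exists (reflect_shape E).
by rewrite !young_reflect yD yE reflect_sub // -reflect_shapeD -e reflect_shapeK eqxx.
Qed.

(** Reflection preserves the description of ribbons by their diagonals. *)
Lemma ribbon_reflect S : is_ribbon n (reflect_shape S) -> is_ribbon n S.
Proof.
move=> rS; have [p sp] := ribbon_spans (leqnn k) hn rS.
have lt := spans_lt (leqnn k) hn sp.
have /and4P[/skew_reflect skS _ _ _] := rS.
have := spans_reflect (leqnn k) (leqnn m) hn lt sp; rewrite reflect_shapeK => sp'.
by apply: (spans_ribbon (leqnn m) skS sp'); clear -lt; lia.
Qed.

Lemma strip_tiling (p s : nat) (l : letter p s) F P : strip n l F P ->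
  partition P F /\ forall S, S \in P -> is_ribbon n S.
Proof.
case: l => l; rewrite /strip => hP.
  by split; [exact: strip_partition hP | move=> S; exact: strip_ribbon hP].
have mR S : S \in P -> reflect_shape S \in reflect_tiling P.
  by move=> SP; apply: imset_f.
have /and3P[_ _ n0] := strip_partition hP.
split; last by move=> S /mR SP; apply: ribbon_reflect; exact: strip_ribbon hP SP.
apply: partition_intro.
- move=> b; apply/idP/exists_inP => [bF|[S SP bS]].
    have bF' : reflect_box b \in reflect_shape F by apply: imset_f.
    have [S' /imsetP[S SP ->]] := strip_in hP bF'.
    by rewrite in_reflect /reflect_box /= -surjective_pairing; exists S.
  have := subsetP (strip_sub hP (mR S SP)) (reflect_box b).
  by rewrite !in_reflect /reflect_box /= -surjective_pairing => /(_ bS).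
- move=> S S' b SP S'P bS bS'; apply: (can_inj (@reflect_shapeK _ _)).
  by apply: (strip_disjoint hP (b := reflect_box b)); rewrite ?mR ?imset_f.
apply: contra n0 => /mR; suff -> : reflect_shape (@set0 (box m k)) = set0 by [].
by apply/setP => b; rewrite in_reflect !inE.
Qed.

End StripBasics.

Section Tableaux.
Variables (n p s : nat) (prec : rel (letter p s)) (la mu : seq nat).
Hypotheses (hn : 0 < n) (prec_total : total prec) (prec_anti : antisymmetric prec).
Hypothesis prec_trans : transitive prec.
Hypothesis yLa : is_young (diagram (nparts la) (head 0 la) la).
Hypothesis yMu : is_young (diagram (nparts la) (head 0 la) mu).
Hypothesis sub_mu : diagram (nparts la) (head 0 la) mu \subset diagram _ _ la.

Notation N := #|{: letter p s}|.
Notation shape := {set boxes la}.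
Notation row_letter := (row_letter prec).
Notation labelled := {set {set boxes la} * letter p s}.
Notation D0 := (diagram (nparts la) (head 0 la) mu).
Notation D1 := (diagram (nparts la) (head 0 la) la).
Implicit Types (P : {ffun 'I_N -> {set shape}}) (D : {ffun 'I_N.+1 -> shape}).

Definition is_chain D : bool :=
  [&& D ord0 == D0, D ord_max == D1 & [forall j, is_young (D j)]].

Definition increasing D : bool :=
  [forall i : 'I_N, D (widen_ord (leqnSn _) i) \subset D (lift ord0 i)].

Definition layer D (i : 'I_N) := D (lift ord0 i) :\: D (widen_ord (leqnSn _) i).

Definition layered D P : bool := [forall i, strip n (row_letter i) (layer D i) (P i)].

(** Here [rank] stands for the inverse of [row_letter]. *)
Definition tableau_of (rank : letter p s -> 'I_N) P : labelled :=
  [set t : shape * letter p s | t.1 \in P (rank t.2)].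

Definition chain_of P : {ffun 'I_N.+1 -> shape} :=
  [ffun j : 'I_N.+1 => D0 :|: \bigcup_(i < N | i < j) cover (P i)].

Section Fixed.
Variables (rank : letter p s -> 'I_N).
Hypotheses (rankK : cancel rank row_letter) (letterK : cancel row_letter rank).
Notation T_ P := (tableau_of rank P).

Lemma ribbons_with_tableau P l : ribbons_with (T_ P) l = P (rank l).
Proof.
apply/setP => S; apply/imsetP/idP => [[[S' l']]|SP].
  by rewrite !inE /= => /andP[h /eqP <-] ->.
by exists (S, l); rewrite // !inE /= SP eqxx.
Qed.

Lemma ribbons_tableau P S : (S \in ribbons (T_ P)) = [exists i, S \in P i].
Proof.
apply/imsetP/existsP => [[[S' l]]|[i SP]].
  by rewrite inE /= => h ->; exists (rank l).
by exists (S, row_letter i); rewrite // inE /= letterK.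
Qed.

Lemma chain_of0 P : chain_of P ord0 = D0.
Proof. by rewrite ffunE big_pred0 ?setU0. Qed.

Lemma chain_ofS P (i : 'I_N) :
  chain_of P (lift ord0 i) = chain_of P (widen_ord (leqnSn _) i) :|: cover (P i).
Proof.
rewrite !ffunE lift0 /= -setUA; congr (_ :|: _).
apply/setP => b; rewrite inE; apply/bigcupP/orP => [[j hj bj]|[/bigcupP[j hj bj]|bi]].
- move: hj; rewrite ltnS leq_eqVlt => /orP[/eqP/ord_inj <-|hj]; first by right.
  by left; apply/bigcupP; exists j.
- by exists j => //; rewrite ltnS ltnW.
by exists i.
Qed.

Lemma tableau_bigcup P (i : 'I_N) :
  D0 :|: \bigcup_(t in T_ P | prec t.2 (row_letter i)) t.1 = chain_of P (lift ord0 i).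
Proof.
rewrite ffunE lift0; congr (_ :|: _); apply/setP => b.
apply/bigcupP/bigcupP => [[[S l]]|[j hj /bigcupP[S SP bS]]].
  rewrite inE /= => /andP[SP]; rewrite -{1}[l]rankK prec_row_letter // => hl bS.
  by exists (rank l) => //; apply/bigcupP; exists S.
exists (S, row_letter j) => //; rewrite inE /= letterK SP prec_row_letter //.
Qed.

Lemma strip_super (l : letter p s) (T : labelled) : super_tableau n prec mu T ->
  strip n l (cover (ribbons_with T l)) (ribbons_with T l).
Proof.
by case/and5P => _ _ _ /forallP h1 /forallP h2; case: l => l; [exact: h1 | exact: h2].
Qed.

(** Ribbons with different labels are different tiles of one tiling, hence disjoint;
thus each strip fills the gap between two diagrams of the chain. *)
Lemma super_chain P : super_tableau n prec mu (T_ P) ->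
  [&& is_chain (chain_of P), increasing (chain_of P) & layered (chain_of P) P].
Proof.
move=> sT; have /and5P[/and3P[_ pT _] /forall_inP fT /forallP yT _ _] := sT.
have /and3P[/eqP covT trT _] := pT.
have inT i S : S \in P i -> S \in ribbons (T_ P).
  by move=> SP; rewrite ribbons_tableau; apply/existsP; exists i.
have PI i j S : S \in P i -> S \in P j -> i = j.
  move=> Si Sj; have Ti : (S, row_letter i) \in T_ P by rewrite inE /= letterK.
  have Tj : (S, row_letter j) \in T_ P by rewrite inE /= letterK.
  have /forall_inP /(_ _ Tj) := fT _ Ti; rewrite /= eqxx /= => /eqP e.
  exact: row_letter_inj e.
have dis (i : 'I_N) b : b \in cover (P i) -> b \notin chain_of P (widen_ord (leqnSn _) i).
  case/bigcupP => S SP bS; rewrite ffunE inE negb_or; apply/andP; split.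
    have : b \in cover (ribbons (T_ P)) by apply/bigcupP; exists S => //; exact: inT SP.
    by rewrite covT inE => /andP[].
  apply/negP => /bigcupP[j hj /bigcupP[S' S'P bS']].
  have e : S = S' by rewrite -(def_pblock trT (inT _ _ SP) bS) -(def_pblock trT (inT _ _ S'P) bS').
  by rewrite -e in S'P; rewrite (PI _ _ _ SP S'P) /= ltnn in hj.
apply/and3P; split.
- apply/and3P; split; first by rewrite chain_of0.
    apply/eqP/setP => b; rewrite ffunE inE; case bM: (b \in D0) => /=.
      by apply/esym; apply: (subsetP sub_mu).
    have <- : (b \in cover (ribbons (T_ P))) = (b \in D1) by rewrite covT inE bM.
    apply/bigcupP/bigcupP => [[i _ /bigcupP[S SP bS]]|[S]].
      by exists S => //; exact: inT SP.
    rewrite ribbons_tableau => /existsP[i SP] bS; exists i; first exact: ltn_ord.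
    by apply/bigcupP; exists S.
  apply/forallP => j; case: (unliftP ord0 j) => [i ->|->]; last by rewrite chain_of0.
  by rewrite -tableau_bigcup; apply: yT.
- by apply/forallP => i; rewrite chain_ofS subsetUl.
apply/forallP => i; have := strip_super (row_letter i) sT.
rewrite ribbons_with_tableau letterK; suff -> : layer (chain_of P) i = cover (P i) by [].
apply/setP => b; rewrite /layer chain_ofS !inE.
by case bP: (b \in cover (P i)); rewrite ?orbT ?orbF ?andNb // (dis _ _ bP).
Qed.

(** Conversely the strips of an increasing chain are disjoint and cover the whole
shape, and the chain can be recovered from them. *)
Lemma chain_super D P : is_chain D -> increasing D -> layered D P ->
  super_tableau n prec mu (T_ P) /\ D = chain_of P.
Proof.
move=> /and3P[/eqP De0 /eqP De1 /forallP yD] /forallP inc /forallP lay.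
have part i : partition (P i) (layer D i) := proj1 (strip_tiling hn (lay i)).
have ribP i S : S \in P i -> is_ribbon n S := proj2 (strip_tiling hn (lay i)) S.
have cov i : cover (P i) = layer D i by case/and3P: (part i) => /eqP.
have DS (i : 'I_N) : D (lift ord0 i) = D (widen_ord (leqnSn _) i) :|: cover (P i).
  by rewrite cov /layer setDE setUIr setUCr setIT; apply/esym/setUidPr; exact: inc.
have DE : D = chain_of P.
  apply/ffunP => -[j hj]; elim: j hj => [|j IHj] hj.
    by have -> : Ordinal hj = ord0 by [apply: ord_inj]; rewrite chain_of0.
  have hj' : j < N by [].
  have -> : Ordinal hj = lift ord0 (Ordinal hj') by apply: ord_inj.
  rewrite DS chain_ofS; congr (_ :|: _).
  have -> : widen_ord (leqnSn _) (Ordinal hj') = Ordinal (ltnW hj) by apply: ord_inj.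
  exact: IHj.
split => //.
have mono (i j : 'I_N.+1) : i <= j -> D i \subset D j.
  move=> ij; rewrite DE !ffunE; apply: setUS; apply/bigcupsP => a ai.
  apply/subsetP => b ba; apply/bigcupP; exists a => //; exact: leq_trans ai ij.
have inS i S b : S \in P i -> b \in S -> b \in D (lift ord0 i).
  by move=> SP bS; rewrite DS inE; apply/orP; right; apply/bigcupP; exists S.
have notS i S b : S \in P i -> b \in S -> b \notin D (widen_ord (leqnSn _) i).
  move=> SP bS; have : b \in cover (P i) by apply/bigcupP; exists S.
  by rewrite cov inE => /andP[].
have same i j S S' b : S \in P i -> S' \in P j -> b \in S -> b \in S' -> i = j.
  wlog ij : i j S S' / i <= j.
    by move=> W; case: (leqP i j) => [|/ltnW] ij Si Sj bS bS';
      [exact: (W _ _ _ _ ij Si Sj) | exact: (esym (W _ _ _ _ ij Sj Si bS' bS))].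
  move=> Si Sj bS bS'; apply: ord_inj; apply/eqP; rewrite eqn_leq ij leqNgt.
  apply/negP => lt; have := notS _ _ _ Sj bS'; apply/negP; rewrite negbK.
  by apply: (subsetP (mono (lift ord0 i) _ _)) (inS _ _ _ Si bS); rewrite lift0.
have n0 i : set0 \notin P i by case/and3P: (part i).
have ne i S : S \in P i -> exists b, b \in S.
  by move=> SP; apply/set0Pn; apply: contraNneq (n0 i) => <-.
apply/and5P; split.
- apply/and3P; split; first exact: skewD.
    apply: partition_intro.
    + move=> b; apply/idP/exists_inP => [|[S]].
        rewrite /skew -De1 DE ffunE !inE => /andP[nb /orP[|/bigcupP[i _ /bigcupP[S SP bS]]]].
          by rewrite (negbTE nb).
        by exists S => //; rewrite ribbons_tableau; apply/existsP; exists i.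
      rewrite ribbons_tableau => /existsP[i SP] bS; rewrite inE -De0 -De1.
      apply/andP; split.
        by apply: contra (notS _ _ _ SP bS); apply/subsetP/mono.
      by apply: (subsetP (mono _ _ _)) (inS _ _ _ SP bS); apply: leq_ord.
    + move=> S S' b; rewrite !ribbons_tableau => /existsP[i Si] /existsP[j Sj] bS bS'.
      have e := same _ _ _ _ _ Si Sj bS bS'; rewrite -e in Sj.
      have /and3P[_ tr _] := part i.
      by rewrite -(def_pblock tr Si bS) -(def_pblock tr Sj bS').
    by rewrite ribbons_tableau; apply/negP => /existsP[i]; rewrite (negbTE (n0 i)).
  apply/forall_inP => S; rewrite ribbons_tableau => /existsP[i]; exact: ribP.
- apply/forall_inP => -[S l]; rewrite inE /= => Sl; apply/forall_inP => -[S' l'].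
  rewrite inE /= => Sl'; apply/implyP => /eqP e; rewrite -e in Sl'.
  have [b bS] := ne _ _ Sl.
  by rewrite -[l]rankK -[l']rankK (same _ _ _ _ _ Sl Sl' bS bS).
- by apply/forallP => l; rewrite -[l]rankK tableau_bigcup -DE.
- apply/forallP => a; have := lay (rank (inl a)).
  by rewrite ribbons_with_tableau -cov rankK.
apply/forallP => a; have := lay (rank (inr a)).
by rewrite ribbons_with_tableau -cov rankK.
Qed.

End Fixed.

Variables (R : comNzRingType) (q : R) (x : 'I_p -> R) (y : 'I_s -> R).
Notation strip_weight := (strip_weight q x y).

Lemma super_weight (T : labelled) : super_tableau n prec mu T ->
  (q ^+ spin T * \prod_(a < p) x a ^+ wt T a * \prod_(b < s) (- y b) ^+ wt' T b =
   \prod_l strip_weight l (ribbons_with T l))%R.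
Proof.
case/and5P => _ /forall_inP fT _ _ _.
have injT : {in T &, injective (fun t : shape * letter p s => t.1)}.
  move=> [S l] [S' l'] tT uT /= e.
  by have /forall_inP /(_ _ uT) := fT _ tT; rewrite /= e eqxx /= => /eqP ->.
rewrite /strip_weight (eq_bigr (fun l : letter p s =>
  (q ^+ (\sum_(S in ribbons_with T l) ribbon_spin S) *
   (letter_variable x y l) ^+ #|ribbons_with T l|)%R)); last first.
  by move=> l _; rewrite big_split /= prodr_const expr_sum.
rewrite big_split /= -mulrA; congr (_ * _)%R.
  rewrite -expr_sum; congr (_ ^+ _)%R; rewrite /spin /ribbons big_imset //=.
  rewrite (partition_big (fun t : shape * letter p s => t.2) predT) //=.
  apply: eq_bigr => l _; rewrite /ribbons_with big_imset /=.
    by apply: eq_bigl => t; rewrite !inE.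
  by move=> t u; rewrite !inE => /andP[tT _] /andP[uT _]; exact: injT.
by rewrite big_sumType.
Qed.

(** Tableaux are reindexed by families of strips, one for each row; the sum over
families fitting a given chain factors over the rows. *)
Lemma super_LLT_chains :
  (super_LLT n prec la mu q x y =
   \sum_(D | is_chain D && increasing D)
     \prod_i \sum_(S | strip n (row_letter i) (layer D i) S) strip_weight (row_letter i) S)%R.
Proof.
have [rank letterK rankK] := row_letter_bij prec.
have bijT : {on [pred T | super_tableau n prec mu T], bijective (tableau_of rank)}.
  exists (fun T : labelled => [ffun i => ribbons_with T (row_letter i)]) => [P _|T _].
    by apply/ffunP => i; rewrite ffunE ribbons_with_tableau letterK.
  apply/setP => -[S l]; rewrite inE ffunE /= rankK; apply/imsetP/idP => [[[S' l']]|SlT].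
    by rewrite inE /= => /andP[h /eqP <-] ->.
  by exists (S, l); rewrite // inE SlT /=.
rewrite /super_LLT (reindex _ bijT) /=.
transitivity (\sum_P \sum_(D | [&& is_chain D, increasing D & layered D P])
   \prod_i strip_weight (row_letter i) (P i))%R.
  rewrite big_mkcond; apply: eq_bigr => P _; case: ifP => [sT|nT].
    rewrite (big_pred1 (chain_of P)).
      rewrite super_weight // (reindex row_letter) /=; last exact: onW_bij (row_letter_bij prec).
      by apply: eq_bigr => i _; rewrite ribbons_with_tableau letterK.
    move=> D; apply/idP/eqP => [/and3P[h1 h2 h3]|->]; last exact: super_chain sT.
    by have [] := chain_super rankK letterK h1 h2 h3.
  apply/esym/big_pred0 => D; apply/negP => /and3P[h1 h2 h3].
  by have [sT _] := chain_super rankK letterK h1 h2 h3; rewrite sT in nT.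
rewrite (exchange_big_dep (fun D => is_chain D && increasing D)) /=; last first.
  by move=> P D _ /and3P[-> ->].
apply: eq_bigr => D /andP[h1 h2].
rewrite (bigA_distr_big_dep (fun i => strip n (row_letter i) (layer D i))
           (fun i => strip_weight (row_letter i))).
apply: eq_bigl => P; rewrite h1 h2 /=; apply/forallP/familyP => h i; exact: h.
Qed.

End Tableaux.

(** * The partition function as a sum over chains *)

Section Partition.
Variables (n p s : nat) (prec : rel (letter p s)) (la mu : seq nat) (r : nat).
Notation N := #|{: letter p s}|.
Notation M := (head 0 la + r).
Notation row_letter := (row_letter prec).

Definition boundary_row (nu : seq nat) : {ffun 'I_M -> varrow} :=
  [ffun c => @boundary_arrow la r nu c].

Definition uncurried (I J : finType) (T : Type) (f : {ffun I -> {ffun J -> T}}) :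
  {ffun I * J -> T} := [ffun a => f a.1 a.2].

Definition curried (I J : finType) (T : Type) (f : {ffun I * J -> T}) :
  {ffun I -> {ffun J -> T}} := [ffun i => [ffun j => f (i, j)]].

Lemma uncurriedK I J T : cancel (@uncurried I J T) (@curried I J T).
Proof. by move=> f; apply/ffunP => i; apply/ffunP => j; rewrite !ffunE. Qed.

Lemma curriedK I J T : cancel (@curried I J T) (@uncurried I J T).
Proof. by move=> f; apply/ffunP => -[i j]; rewrite !ffunE. Qed.

Variables (R : comNzRingType) (q : R) (x : 'I_p -> R) (y : 'I_s -> R).

(** Given the vertical arrows, the rows are independent. *)
Lemma partition_function_rows :
  (partition_function n prec la mu r q x y =
   \sum_(V : {ffun 'I_N.+1 -> {ffun 'I_M -> varrow}}
          | (V ord0 == boundary_row mu) && (V ord_max == boundary_row la))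
     \prod_(i < N) row_sum n q x y (row_letter i)
                     (V (widen_ord (leqnSn _) i)) (V (lift ord0 i)))%R.
Proof.
pose cols := {ffun 'I_N.+1 -> {ffun 'I_M -> varrow}}.
pose rows := {ffun 'I_N -> {ffun 'I_M.+1 -> n.-tuple harrow}}.
pose h (VH : cols * rows) := (uncurried VH.1, uncurried VH.2).
have hbij : bijective h.
  exists (fun st => (curried st.1, curried st.2)) => -[a b].
    by rewrite /h /= !uncurriedK.
  by rewrite /h /= !curriedK.
rewrite /partition_function (reindex h) /=; last exact: onW_bij hbij.
rewrite (eq_bigl (fun VH : cols * rows =>
   ((VH.1 ord0 == boundary_row mu) && (VH.1 ord_max == boundary_row la)) &&
   (VH.2 \in ffun_on (fun H => row_boundary H)))); last first.
  move=> [V H]; rewrite /boundary /h /= -andbA; congr [&& _, _ & _].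
  - apply/forallP/eqP => [e|e c]; last by rewrite !ffunE /= e ffunE.
    by apply/ffunP => c; have /eqP := e c; rewrite !ffunE.
  - apply/forallP/eqP => [e|e c]; last by rewrite !ffunE /= e ffunE.
    by apply/ffunP => c; have /eqP := e c; rewrite !ffunE.
  apply/andP/ffun_onP => [[/forallP h1 /forallP h2] i|e].
    by have := h1 i; have := h2 i; rewrite !ffunE /row_boundary unfold_in /= => -> ->.
  by split; apply/forallP => i; have := e i; rewrite !ffunE unfold_in => /andP[].
rewrite -(pair_big (fun V : cols => (V ord0 == boundary_row mu) && (V ord_max == boundary_row la))
   (fun H : rows => H \in ffun_on (fun H => row_boundary H))
   (fun V H => state_weight prec q x y (h (V, H)))) /=.
apply: eq_bigr => V _; rewrite /row_sum.
rewrite (bigA_distr_big (fun H => row_boundary H)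
  (fun i H => row_weight q x y (row_letter i) (V (widen_ord (leqnSn _) i)) (V (lift ord0 i)) H)).
apply: eq_bigr => H _; apply: eq_bigr => i _; apply: eq_bigr => c _.
by rewrite /edge_N /edge_S /edge_W /edge_E /h /= !ffunE.
Qed.

End Partition.

Lemma nth_nparts la i : is_partition la -> nparts la <= i -> nth 0 la i = 0.
Proof.
move=> hla hi; apply/eqP; rewrite -leqn0 leqNgt; apply/negP => pos.
suff : i < nparts la by rewrite ltnNge hi.
have sz : i < size la by rewrite ltnNge; apply/negP => h; rewrite nth_default in pos.
rewrite /nparts -[la](cat_take_drop i.+1) count_cat.
have /eqP -> : count (leq 1) (take i.+1 la) == i.+1.
  rewrite -[X in _ == X](size_takel (s := la) (n0 := i.+1)) // -all_count.
  apply/(all_nthP 0) => j; rewrite size_takel // => hj; rewrite nth_take //.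
  by rewrite ltnS in hj; apply: leq_trans pos (nth_partition hla hj).
exact: leq_addr.
Qed.

Theorem theorem4p1 (n p s : nat) (hn : 0 < n)
    (prec : rel ('I_p + 'I_s)%type)
    (prec_total : total prec) (prec_anti : antisymmetric prec)
    (prec_trans : transitive prec)
    (prec_A : forall i j : 'I_p, prec (inl i) (inl j) = (i <= j))
    (prec_A' : forall i j : 'I_s, prec (inr i) (inr j) = (i <= j))
    (la mu : seq nat) (hla : is_partition la) (hmu : is_partition mu)
    (hsub : subpartition mu la) (htile : tileable n la mu)
    (r : nat) (hr : nparts la <= r)
    (R : comNzRingType) (q : R) (x : 'I_p -> R) (y : 'I_s -> R) :
  partition_function n prec la mu r q x y = super_LLT n prec la mu q x y.
Proof.
pose m := nparts la; pose k := head 0 la.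
have la_k i : nth 0 la i <= k by rewrite /k -nth0; apply: nth_partition.
have la_m i : m <= i -> nth 0 la i = 0 := nth_nparts hla (i := i).
have mu_k i : nth 0 mu i <= k := leq_trans (hsub i) (la_k i).
have mu_m i : m <= i -> nth 0 mu i = 0.
  by move=> hi; have := hsub i; rewrite la_m // leqn0 => /eqP.
have yLa : is_young (diagram m k la) by apply/youngP; exact: down_closed_diagram.
have yMu : is_young (diagram m k mu) by apply/youngP; exact: down_closed_diagram.
have sub : diagram m k mu \subset diagram m k la.
  by apply/subsetP => b; rewrite !inE => h; apply: leq_trans h (hsub _).
have bdE nu : is_partition nu -> (forall i, nth 0 nu i <= k) ->
    (forall i, m <= i -> nth 0 nu i = 0) -> boundary_row la r nu = arrows r (diagram m k nu).
  by move=> h1 h2 h3; apply/ffunP => c; rewrite !ffunE (bead_diagram hr _ h1 h2 h3).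
rewrite partition_function_rows (super_LLT_chains hn prec_total prec_anti prec_trans yLa yMu sub).
set N := #|{: letter p s}|; rewrite !bdE //.
pose F (V : {ffun 'I_N.+1 -> {ffun 'I_(k + r) -> varrow}}) : R :=
  (\prod_(i < N) row_sum n q x y (row_letter prec i)
      (V (widen_ord (leqnSn _) i)) (V (lift ord0 i)))%R.
(* [down] inverts [up] on sequences of bead rows of Young diagrams *)
pose up (D : {ffun 'I_N.+1 -> {set box m k}}) := [ffun j => arrows r (D j)].
pose down (V : {ffun 'I_N.+1 -> {ffun 'I_(k + r) -> varrow}}) : {ffun 'I_N.+1 -> {set box m k}} :=
  [ffun j => odflt set0 [pick D | is_young D && (arrows r D == V j)]].
pose from_young (V : {ffun 'I_N.+1 -> {ffun 'I_(k + r) -> varrow}}) :=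
  [forall j, exists D : {set box m k}, is_young D && (arrows r D == V j)].
have upK V : from_young V -> up (down V) = V.
  move/forallP => h; apply/ffunP => j; rewrite !ffunE; case: pickP => [D /andP[_ /eqP //]|noD].
  by have /existsP[D] := h j; rewrite noD.
rewrite -/F (bigID from_young) /= [X in (_ + X)%R]big1 ?addr0; last first.
  (* from the last row upwards, a row with nonzero sum leads to a Young diagram *)
  move=> V /andP[/andP[_ /eqP Vla]]; apply: contraNeq => F0; apply/forallP.
  suff H i : i <= N -> forall j : 'I_N.+1, j + i = N ->
      exists D : {set box m k}, is_young D && (arrows r D == V j).
    by move=> j; apply/existsP; apply: (H (N - j));
      [exact: leq_subr | by rewrite subnKC // -ltnS].
  elim: i => [|i IHi] hi j ji.
    exists (diagram m k la); rewrite yLa -Vla (_ : j = ord_max) ?eqxx //; apply: ord_inj.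
    by rewrite addn0 in ji.
  have hj : j < N by clear -ji; lia.
  have [|D /andP[yD /eqP VD]] := IHi (ltnW hi) (lift ord0 (Ordinal hj)).
    by rewrite lift0 /= addSnnS.
  have jE : j = widen_ord (leqnSn _) (Ordinal hj) by apply: ord_inj.
  have [E0|[E [P [yE _ VE _]]]] := row_sum_strip_cases hr hn q x y
      (row_letter prec (Ordinal hj)) (V j) yD.
    by case/eqP: F0; rewrite /F (bigD1 (Ordinal hj)) //= -VD -jE E0 mul0r.
  by exists E; rewrite yE VE eqxx.
rewrite (reindex_onto up down) /=; last by move=> V /andP[_ /upK].
rewrite [RHS]big_mkcond [LHS]big_mkcond; apply: eq_bigr => D _.
have youngE : down (up D) = D <-> forall j, is_young (D j).
  split=> [/ffunP e j|yD].
    rewrite -e !ffunE; case: pickP => [E /andP[] //|_] /=.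
    by apply/youngP => b c; rewrite inE.
  apply/ffunP => j; rewrite !ffunE; case: pickP => [E /andP[yE /eqP]|/(_ (D j))].
    by move=> /(arrows_inj hr yE (yD j)).
  by rewrite yD eqxx.
case: (boolP [forall j, is_young (D j)]) => [/forallP yD|nyD]; last first.
  have -> : (down (up D) == D) = false.
    by apply/eqP => /youngE/forallP h; rewrite h in nyD.
  by rewrite /is_chain (negbTE nyD) !andbF.
have -> : from_young (up D).
  by apply/forallP => j; apply/existsP; exists (D j); rewrite yD ffunE eqxx.
have /youngE -> := yD; rewrite eqxx !andbT !ffunE.
have arrowsE j E : is_young E -> (arrows r (D j) == arrows r E) = (D j == E).
  by move=> yE; apply/eqP/eqP => [/(arrows_inj hr (yD j) yE)|->].
rewrite !arrowsE // /is_chain (_ : [forall j, is_young (D j)]) ?andbT; last exact/forallP.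
case: (_ && _) => //=; rewrite /F.
rewrite (eq_bigr (fun i : 'I_N => row_sum n q x y (row_letter prec i)
  (arrows r (D (widen_ord (leqnSn _) i))) (arrows r (D (lift ord0 i))))); last first.
  by move=> i _; rewrite !ffunE.
case: (boolP (increasing D)) => [/forallP inc|].
  by apply: eq_bigr => i _; rewrite row_sum_strips // inc.
rewrite negb_forall => /existsP[i ni].
by rewrite (bigD1 i) //= row_sum_strips // (negbTE ni) mul0r.
Qed.
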